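(* Let $\mathcal S=(\mathcal P,\mathcal L)$ be a finite thick generalized quadrangle of order $(s,t)$ admitting an automorphism group $G$ acting regularly on $\mathcal P$, with $\mathcal P$ identified with $G$ as in the context. Let $\theta\in\mathrm{Aut}(G)$ be a multiplier and $H=C_G(\theta)$. Then either $H=1$, or $|H|>1$ and the fixed substructure $\mathcal S_\theta=(\mathcal P_0(\theta),\mathcal L_0(\theta))$ satisfies one of the following: (a) $\mathcal S_\theta$ is a partial ovoid, and $|H|\le 1+st$; (b) all points of $H$ are incident with a common line, and $|H|$ divides $1+s$; (c) $\mathcal S_\theta$ is a grid with parameters $(s_1,s_2)$, and there are subgroups $Y_1,Y_2$ of $H$ with $H=Y_1Y_2$, $|Y_i|=s_i+1$, $s_i+1\mid s+1$, and the points of $Y_i$ are incident with a common line, for $i=1,2$; (c') $\mathcal S_\theta$ is a thin subquadrangle of order $(s_1,1)$ with $s_1\le\min\{s,t\}$, and $H=\langle X_1,g_1\rangle$ for a subgroup $X_1$ of order $\frac{s_1+1}{2}$ and an element $g_1\in H$, such that the sets of points of $H$ on the two fixed lines incident with $1$ are $X_1\cup g_1X_1$ and $g_1X_1g_1^{-1}\cup X_1g_1^{-1}$ respectively; (d) $\mathcal S_\theta$ is a thin subquadrangle of order $(1,t_1)$ with $2\le t_1\le\min\{s,t\}$, and $H$ has a subgroup of index $2$ consisting of pairwise noncollinear points; (e) $\mathcal S_\theta$ is a subquadrangle of order $(s',t')$ with $\min\{s',t'\}\ge 2$.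
   Context: A finite generalized quadrangle of order $(s,t)$ is a point-line incidence structure whose incidence graph is bipartite of diameter $4$ and girth $8$, with $s+1$ points per line and $t+1$ lines per point; thick means $s,t\ge2$. Fix a point $p$ and identify $\mathcal P$ with $G$ via $p^g\mapsto g$; $G$ acts by right multiplication. An automorphism $\theta$ of the group $G$ is a multiplier if $g\mapsto g^\theta$ induces an automorphism of $\mathcal S$; $C_G(\theta)$ is its fixed-point subgroup. $\mathcal P_0(\theta)$, $\mathcal L_0(\theta)$ are the sets of fixed points and fixed lines, and $\mathcal S_\theta$ is the incidence substructure they induce. $\mathcal S_\theta$ is a partial ovoid if $\mathcal L_0(\theta)=\varnothing$ and the points of $\mathcal P_0(\theta)$ are pairwise noncollinear. A grid with parameters $(s_1,s_2)$ has points $x_{i,j}$ ($0\le i\le s_1$, $0\le j\le s_2$) and lines $\ell_0,\dots,\ell_{s_1},\ell'_0,\dots,\ell'_{s_2}$ with $x_{i,j}$ on $\ell_k$ iff $i=k$ and on $\ell'_k$ iff $j=k$; a dual grid with parameters $(t_1,t_2)$ is the point-line dual of a grid with parameters $(t_2,t_1)$. A thin subquadrangle of order $(s_1,1)$ is a grid with parameters $(s_1,s_1)$; one of order $(1,t_1)$ is a dual grid with parameters $(t_1,t_1)$. A subquadrangle of order $(s',t')$ is a substructure that is itself a generalized quadrangle of that order. *)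

(* Defs.v *)
From mathcomp Require Import all_boot all_fingroup.

Set Implicit Arguments.
Unset Strict Implicit.
Unset Printing Implicit Defensive.

(* [w] lists the vertices of a walk after its first one, so that its     *)
(* length is [size w].                                                   *)
Definition diameter_is (T : finType) (e : rel T) (d : nat) : Prop :=
  (forall u v : T, exists w : seq T, [/\ path e u w, last u w = v & size w <= d])
  /\ (exists u v : T, forall w : seq T, path e u w -> last u w = v -> d <= size w).

(* The bound [2 < size c] excludes back-and-forth walks along an edge.   *)
Definition girth_is (T : finType) (e : rel T) (n : nat) : Prop :=
  (exists c : seq T, [/\ 2 < size c, ucycle e c & size c = n])
  /\ (forall c : seq T, 2 < size c -> ucycle e c -> n <= size c).

Record incidence_structure : Type := IncidenceStructure {
  point : finType;
  line : finType;
  inc : point -> line -> bool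
}.

Definition incidence_graph (S : incidence_structure) : rel (point S + line S) :=
  fun u v =>
    match u, v with
    | inl x, inr l => inc x l
    | inr l, inl x => inc x l
    | _, _ => false
    end.

Definition collinear (S : incidence_structure) (x y : point S) : bool :=
  [exists l : line S, inc x l && inc y l].

Definition dual (S : incidence_structure) : incidence_structure :=
  IncidenceStructure (fun (l : line S) (x : point S) => inc x l).

Definition substructure (S : incidence_structure)
    (A : {set point S}) (B : {set line S}) : incidence_structure :=
  @IncidenceStructure {x : point S | x \in A} {l : line S | l \in B}
    (fun x l => inc (val x) (val l)).

Definition isomorphic (S S' : incidence_structure) : Prop :=
  exists (f : point S -> point S') (g : line S -> line S'),
    [/\ bijective f, bijective g & forall x l, inc (f x) (g l) = inc x l].

Definition generalized_quadrangle (s t : nat) (S : incidence_structure) : Prop :=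
  [/\ diameter_is (@incidence_graph S) 4,
      girth_is (@incidence_graph S) 8,
      forall l : line S, #|[set x : point S | inc x l]| = s.+1
    & forall x : point S, #|[set l : line S | inc x l]| = t.+1].

(* x_{i,j} is (i, j), l_k is inl k and l'_k is inr k.                    *)
Definition grid (s1 s2 : nat) : incidence_structure :=
  @IncidenceStructure ('I_s1.+1 * 'I_s2.+1)%type ('I_s1.+1 + 'I_s2.+1)%type
    (fun x l => match l with inl k => x.1 == k | inr k => x.2 == k end).

Definition is_grid (s1 s2 : nat) (S : incidence_structure) : Prop :=
  isomorphic S (grid s1 s2).

Definition is_dual_grid (t1 t2 : nat) (S : incidence_structure) : Prop :=
  isomorphic S (dual (grid t2 t1)).

(* Quadrangles of order (s1, 1) and (1, t1); the second conjunct is the  *)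
(* usual explicit description of these thin quadrangles.                 *)
Definition thin_quadrangle_s1 (s1 : nat) (S : incidence_structure) : Prop :=
  generalized_quadrangle s1 1 S /\ is_grid s1 s1 S.

Definition thin_quadrangle_1t (t1 : nat) (S : incidence_structure) : Prop :=
  generalized_quadrangle 1 t1 S /\ is_dual_grid t1 t1 S.

(* Pairs (permutation of the points, permutation of the lines), with the *)
(* componentwise group law.  Permutations compose from left to right, so *)
(* x^(g * h) = (x^g)^h below.                                            *)
Notation biperm S := ({perm point S} * {perm line S})%type.

Definition automorphisms (S : incidence_structure) : {set biperm S} :=
  [set f : biperm S | [forall x, forall l, inc (f.1 x) (f.2 l) == inc x l]].

Definition pt (S : incidence_structure) (x : point S) (g : biperm S) : point S :=
  g.1 x.

Lemma ptM (S : incidence_structure) (x : point S) (g h : biperm S) :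
  pt x (g * h)%g = pt (pt x g) h.
Proof. exact: permM. Qed.

Definition regular_on_points (S : incidence_structure) (G : {set biperm S}) : Prop :=
  forall x y : point S, exists! g : biperm S, g \in G /\ pt x g = y.

(* [theta] is a multiplier of [G], with respect to the base point [p],   *)
(* when it induces some automorphism [phi] of [S] in the sense below.    *)
(* In a generalized quadrangle a line is determined by its points, so    *)
(* that [phi] is unique; carrying it explicitly gives the action of      *)
(* [theta] on lines.                                                     *)
Definition induces (S : incidence_structure) (G : {set biperm S}) (p : point S)
    (theta : {perm biperm S}) (phi : biperm S) : Prop :=
  phi \in automorphisms S
  /\ (forall g, g \in G -> pt (pt p g) phi = pt p (theta g)).

Definition fixed_points (S : incidence_structure) (phi : biperm S) : {set point S} :=
  [set x | phi.1 x == x].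

Definition fixed_lines (S : incidence_structure) (phi : biperm S) : {set line S} :=
  [set l | phi.2 l == l].

Definition fixed_substructure (S : incidence_structure) (phi : biperm S) :
    incidence_structure :=
  substructure (fixed_points phi) (fixed_lines phi).

Definition fixed_subgroup (gT : finGroupType) (G : {set gT}) (theta : {perm gT}) :
    {set gT} :=
  [set g in G | theta g == g].

Definition pairwise_noncollinear (S : incidence_structure) (A : {set point S}) : Prop :=
  forall x y, x \in A -> y \in A -> x != y -> ~~ collinear x y.

(* Collinearity is that of the ambient structure [S], not that of the    *)
(* substructure induced by [A] and [B].                                  *)
Definition partial_ovoid (S : incidence_structure)
    (A : {set point S}) (B : {set line S}) : Prop :=
  B = set0 /\ pairwise_noncollinear A.

Definition points_of (S : incidence_structure) (p : point S) (A : {set biperm S}) :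
    {set point S} :=
  [set pt p g | g in A].

Definition on_common_line (S : incidence_structure) (A : {set point S}) : Prop :=
  exists l : line S, forall x, x \in A -> inc x l.

(* Main.v *)
Require Import Defs.
From mathcomp Require Import all_boot all_fingroup.
From mathcomp Require Import zify.

(* The subgroup H commutes with phi and acts regularly on the fixed points,  *)
(* so every fixed point is on the same number r of fixed lines.  Fixed       *)
(* points and lines are closed under joining, meeting and projecting, and    *)
(* the theorem is a case distinction on r.  If r = 0, S_theta is a partial   *)
(* ovoid.  If r = 1, or if r >= 2 and some fixed line has a single fixed     *)
(* point, all fixed points are on one line, on whose s + 1 points H acts     *)
(* semiregularly.  Otherwise every fixed line has at least two fixed points. *)
(* For r = 2, S_theta is a grid, and H either preserves the two parallel     *)
(* classes of lines, when it is the product of the stabilizers of the two    *)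
(* lines on p, or swaps them.  For r >= 3 all fixed lines have the same      *)
(* number of fixed points, and if that number is 2 we are in the dual of a   *)
(* grid, whose two classes of pairwise noncollinear points are permuted by   *)
(* H.  The inequalities t1 <= s and s1 <= t hold because the collinearity    *)
(* graph of a quadrangle of order (s, t) has second eigenvalue s - 1, which  *)
(* bounds by s + 1 the size of the sides of a dual grid.                     *)

Set Implicit Arguments.
Unset Strict Implicit.
Unset Printing Implicit Defensive.

(** * Quadrangles by axioms *)

(** The argument rests on two separations. Diameter and girth are traded for three axioms,
    [quadrangular], which pass to the dual and to closed substructures; [gq_quadrangular] and
    [quadrangular_gq] translate in both directions. The multiplier is traded for a group H acting
    regularly on the points of a closed substructure [(A, B)] and preserving its lines, after which
    [theta] no longer appears.

    Regularity turns geometry into group theory: subsets of H correspond to sets of fixed points,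
    and the stabilizer of a line acts semiregularly on its s + 1 points, whence the divisibilities
    ([dvdn_card_stabilizer]). With two lines on each point, parallelism has at most two classes
    ([parallel_class]), and an element of H either preserves or exchanges them: [parallel_grid_case]
    and [swapped_grid_case]. The dual grid of [dual_grid_case] is the same geometry read in the
    dual, and [three_lines_case] separates it from the thick subquadrangles. The bounds by min(s, t)
    that no direct count gives come from [complete_bipartite_le], applied to S for dual grids and to
    its dual for grids. *)

Definition partial_linear (S : incidence_structure) : Prop :=
  forall (x y : point S) (l m : line S),
    inc x l -> inc y l -> inc x m -> inc y m -> x != y -> l = m.

(** Degenerate triangles are allowed: concluding that z lies on l, rather than a contradiction,
    avoids checking that z differs from x and y or that the lines are distinct. *)
Definition triangle_free (S : incidence_structure) : Prop :=
  forall (x y z : point S) (l m n : line S),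
    inc x l -> inc y l -> x != y -> inc y m -> inc z m -> inc z n -> inc x n ->
    inc z l.

(** Existence is enough: the other two axioms make the projection and the joining line unique. *)
Definition has_projections (S : incidence_structure) : Prop :=
  forall (x : point S) (l : line S), ~~ inc x l ->
    exists y m, [/\ inc x m, inc y m & inc y l].

Definition quadrangular (S : incidence_structure) : Prop :=
  [/\ partial_linear S, triangle_free S & has_projections S].

Lemma quadrangular_dual (S : incidence_structure) :
  quadrangular S -> quadrangular (dual S).
Proof.
case=> lin tri pr; split.
- move=> l m x y /= xl xm yl ym nlm; apply/eqP; apply: contraNT nlm => nxy.
  by apply/eqP; apply: (lin x y).
- move=> l m n x y z /= xl xm nlm ym yn zn zl.
  have [<-//|nyz] := eqVneq z x.
  have [E|nyz'] := eqVneq y z.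
    have [<-//|nxy] := eqVneq y x.
    by rewrite (lin x y l m) ?eqxx // ?E // 1?eq_sym // in nlm; rewrite -E.
  exact: (tri y z x n l m).
- move=> l x /= nxl; have [y [m [xm ym yl]]] := pr _ _ nxl.
  by exists m, y.
Qed.

(** Two points on two common lines form a 4-cycle and a proper triangle a 6-cycle, both shorter than
    the girth. A point and a line are at odd distance at most 4, and a walk of length 3 between them
    is a projection. *)
Lemma gq_quadrangular (s t : nat) (S : incidence_structure) :
  generalized_quadrangle s t S -> quadrangular S.
Proof.
case=> [[diam _] [_ girth] _ _].
have lin : partial_linear S.
  move=> x y l m xl yl xm ym nxy; apply/eqP/negPn/negP => nlm.
  have := girth [:: inl x; inr l; inl y; inr m] isT.
  rewrite /ucycle /= xl yl xm ym /= !inE /=.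
  have -> : (inr l == inr m :> point S + line S) = (l == m) by [].
  have -> : (inl x == inl y :> point S + line S) = (x == y) by [].
  by rewrite (negbTE nxy) (negbTE nlm) => /(_ isT).
have nsame (x y : point S) l : inc x l -> ~~ inc y l -> x != y.
  by move=> xl; apply: contraNneq => <-.
have nsamel (x : point S) l m : inc x l -> ~~ inc x m -> l != m.
  by move=> xl; apply: contraNneq => <-.
split=> //.
- move=> x y z l m n xl yl nxy ym zm zn xn; apply/negPn/negP => zl.
  have nxz := nsame _ _ _ xl zl; have nyz := nsame _ _ _ yl zl.
  have nml := nsamel _ _ _ zm zl; have nnl := nsamel _ _ _ zn zl.
  have nmn : m != n.
    apply: contraNneq zl => Emn.
    by rewrite (lin x y l n) // -Emn.
  have := girth [:: inl x; inr l; inl y; inr m; inl z; inr n] isT.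
  rewrite /ucycle [path.cycle _ _]/= xl yl ym zm zn xn.
  have E1 (a b : point S) : (inl a == inl b :> point S + line S) = (a == b) by [].
  have E2 (a b : line S) : (inr a == inr b :> point S + line S) = (a == b) by [].
  have E3 a b : (inl a == inr b :> point S + line S) = false by [].
  have E4 a b : (inr a == inl b :> point S + line S) = false by [].
  rewrite [uniq _]/= !inE !(E1, E2, E3, E4) (negbTE nxy) (negbTE nxz).
  rewrite (negbTE nyz) (eq_sym l) (negbTE nml) (eq_sym l) (negbTE nnl) (negbTE nmn).
  by move=> /(_ isT).
- move=> x l nxl; have [w [+ + +]] := diam (inl x) (inr l).
  case: w => [|[a|m] [|[y|b] [|[c|n] [|[d|q] [|? ?]]]]] //=; rewrite ?andbF //=.
    by rewrite andbT => xl []El; rewrite -El xl in nxl.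
  by case/and4P=> xm ym yn _ [] <- _; exists y, m.
Qed.

Lemma exists_other (T : finType) (A : {set T}) (x : T) :
  1 < #|A| -> exists2 y, y \in A & x != y.
Proof.
case/card_gt1P=> a [b [aA bA nab]].
by have [->|nxa] := eqVneq x a; [exists b | exists a].
Qed.

(** * From the axioms back to diameter and girth *)

Section QuadrangularGQ.

Variables (s t : nat) (S : incidence_structure) (x0 : point S).
Hypotheses (QS : quadrangular S) (s_gt0 : 0 < s) (t_gt0 : 0 < t).
Hypothesis card_points : forall l : line S, #|[set x : point S | inc x l]| = s.+1.
Hypothesis card_lines : forall x : point S, #|[set l : line S | inc x l]| = t.+1.

Let lin : partial_linear S. Proof. by case: QS. Qed.
Let tri : triangle_free S. Proof. by case: QS. Qed.
Let pr : has_projections S. Proof. by case: QS. Qed.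

Let other_point (x : point S) l : exists2 y, inc y l & x != y.
Proof.
have [|y] := @exists_other _ [set y : point S | inc y l] x.
  by rewrite card_points ltnS.
by rewrite inE => yl nxy; exists y.
Qed.

Let other_line (l : line S) x : exists2 m, inc x m & l != m.
Proof.
have [|y] := @exists_other _ [set m : line S | inc x m] l.
  by rewrite card_lines ltnS.
by rewrite inE => yl nxy; exists y.
Qed.

Let line_on (x : point S) : exists l, inc x l.
Proof.
have /card_gt0P [l] : 0 < #|[set l : line S | inc x l]| by rewrite card_lines.
by rewrite inE => xl; exists l.
Qed.

Let point_on (l : line S) : exists x, inc x l.
Proof.
have /card_gt0P [x] : 0 < #|[set x : point S | inc x l]| by rewrite card_points.
by rewrite inE => xl; exists x.
Qed.

(** Its ends [x0] and [z] are at distance 4, so it shows that the diameter is attained; it is also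
    half of the octagon that attains the girth. *)
Let two_path : exists (l m : line S) (y z : point S),
  [/\ inc x0 l, inc y l, inc y m, inc z m & [/\ l != m, ~~ inc x0 m & ~~ collinear x0 z]].
Proof.
have [l xl] := line_on x0; have [y yl nxy] := other_point x0 l.
have [m ym nlm] := other_line l y; have [z zm nyz] := other_point y m.
have xm : ~~ inc x0 m by apply: contraNN nlm => xm; apply/eqP/(lin (x := x0) (y := y)).
exists l, m, y, z; split=> //; split=> //.
apply: contraNN xm => /existsP [n /andP [xn zn]].
exact: (tri (x := y) (y := z) (l := m) (m := n) (n := l)).
Qed.

Let diameter4 : diameter_is (@incidence_graph S) 4.
Proof.
split=> [u v|].
  case: u v => [x|l] [y|m].
  - have [l yl] := line_on y; have [xl|/pr [z [m [xm zm zl]]]] := boolP (inc x l).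
      by exists [:: inr l; inl y]; rewrite /= xl yl.
    by exists [:: inr m; inl z; inr l; inl y]; rewrite /= xm zm zl yl.
  - have [xl|/pr [z [l [xl zl zm]]]] := boolP (inc x m).
      by exists [:: inr m]; rewrite /= xl.
    by exists [:: inr l; inl z; inr m]; rewrite /= xl zl zm.
  - have [xl|/pr [z [m [xm zm zl]]]] := boolP (inc y l).
      by exists [:: inl y]; rewrite /= xl.
    by exists [:: inl z; inr m; inl y]; rewrite /= xm zm zl.
  - have [y ym] := point_on m; have [yl|/pr [z [n [yn zn zl]]]] := boolP (inc y l).
      by exists [:: inl y; inr m]; rewrite /= ym yl.
    by exists [:: inl z; inr n; inl y; inr m]; rewrite /= zl zn yn ym.
have [l [m [y [z [xl yl ym zm [nlm xm ncxz]]]]]] := two_path.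
exists (inl x0), (inl z) => w.
case: w => [|[a|a] [|[b|b] [|[c|c] [|? ?]]]] //=; rewrite ?andbF //.
  by move=> _ [E]; rewrite E zm in xm.
by case/and3P=> xa ba _ [E]; case/existsP: ncxz; exists a; rewrite xa -E ba.
Qed.

Let inlE (x y : point S) : (inl x == inl y :> point S + line S) = (x == y).
Proof. by []. Qed.
Let inrE (x y : line S) : (inr x == inr y :> point S + line S) = (x == y).
Proof. by []. Qed.
Let inlrE x y : (inl x == inr y :> point S + line S) = false.
Proof. by []. Qed.
Let inrlE x y : (inr x == inl y :> point S + line S) = false.
Proof. by []. Qed.
Let sumE := (inlE, inrE, inlrE, inrlE).

Let no_square (x y : point S) (l m : line S) :
  inc x l -> inc y l -> inc x m -> inc y m -> x != y -> l != m -> False.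
Proof. by move=> xl yl xm ym nxy /eqP; apply; apply: (lin xl yl). Qed.

Let no_hexagon (x y z : point S) (l m n : line S) :
  inc x l -> inc y l -> x != y -> inc y m -> inc z m -> inc z n -> inc x n ->
  y != z -> l != m -> False.
Proof.
move=> xl yl nxy ym zm zn xn nyz.
exact: (no_square yl (tri xl yl nxy ym zm zn xn)).
Qed.

Let girth8 : girth_is (@incidence_graph S) 8.
Proof.
split=> [|c].
  have [l [m [y [z [xl yl ym zm [nlm xm ncxz]]]]]] := two_path.
  have ncol n : inc x0 n -> ~~ inc z n.
    by move=> xn; apply: contraNN ncxz => zn; apply/existsP; exists n; rewrite xn.
  have nxy : x0 != y by apply: contraNneq xm => ->.
  have nyz : y != z by apply: contraNneq (ncol _ xl) => <-.
  (* The octagon is closed by projecting [x0] to a second line [n] on [z]; the rest checks that its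
     eight vertices are distinct. *)
  have [n zn nmn] := other_line m z.
  have xn : ~~ inc x0 n by apply: contraL zn => /ncol.
  have [q [k [xk qk qn]]] := pr xn.
  have nxq : x0 != q by apply: contraNneq xn => ->.
  have nxz : x0 != z by apply: contraNneq xm => ->.
  have yn : ~~ inc y n by apply/negP => yn; apply: (no_square ym zm yn zn).
  have nyq : y != q by apply: contraNneq yn => ->.
  have nzq : z != q by apply: contraNneq (ncol _ xk) => ->.
  have nln : l != n by apply: contraNneq xn => <-.
  have nlk : l != k.
    apply: contraNneq yn => E; rewrite -E in qk.
    exact: (tri (x := z) (y := q) (z := y) (m := l) (n := m)).
  have nmk : m != k by apply: contraNneq xm => ->.
  have nnk : n != k by apply: contraNneq xn => ->.
  exists [:: inl x0; inr l; inl y; inr m; inl z; inr n; inl q; inr k].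
  split=> //; rewrite /ucycle [path.cycle _ _]/= xl yl ym zm zn qn qk xk.
  rewrite [uniq _]/= !inE !sumE (negbTE nxy) (negbTE nxz) (negbTE nxq) (negbTE nyz).
  rewrite (negbTE nyq) (negbTE nzq) (negbTE nlm) (negbTE nln) (negbTE nlk).
  by rewrite (negbTE nmn) (negbTE nmk) (negbTE nnk).
case: c => [|a [|b [|c [|d [|e [|f [|g [|? ?]]]]]]]] //= _; rewrite /ucycle.
- by move: a b c => [a|a] [b|b] [c|c] //=; rewrite ?andbF.
- move: a b c d => [a|a] [b|b] [c|c] [d|d] //=;
    rewrite ?andbF // ?(inE, sumE) /= ?andbT ?orbF => /andP [] /and4P [] ? ? ? ? /andP [] ? ?.
    by exfalso; apply: (@no_square a c b d).
  by exfalso; apply: (@no_square b d a c).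
- by move: a b c d e => [a|a] [b|b] [c|c] [d|d] [e|e] //=; rewrite ?andbF.
- move: a b c d e f => [a|a] [b|b] [c|c] [d|d] [e|e] [f|f] //=;
    rewrite ?andbF // ?(inE, sumE) /= ?andbT ?orbF ?negb_or.
    case/andP=> /and5P [] ? ? ? ? /andP [] ? ? /and4P [] /andP [] ? ? /andP [] ? ? ? ?.
    by exfalso; apply: (@no_hexagon a c e b d f).
  case/andP=> /and5P [] ? ? ? ? /andP [] ? ? /and4P [] /andP [] ? ? /andP [] ? ? ? ?.
  by exfalso; apply: (@no_hexagon b d f c e a).
- by move: a b c d e f g => [a|a] [b|b] [c|c] [d|d] [e|e] [f|f] [g|g] //=; rewrite ?andbF.
Qed.

Lemma quadrangular_gq : generalized_quadrangle s t S.
Proof. by split. Qed.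

End QuadrangularGQ.

(** * Counting and the eigenvalue bound *)

Section Collinearity.

Variables (s t : nat) (S : incidence_structure).
Hypothesis QS : quadrangular S.
Hypothesis card_points : forall l : line S, #|[set x : point S | inc x l]| = s.+1.
Hypothesis card_lines : forall x : point S, #|[set l : line S | inc x l]| = t.+1.

Let lin : partial_linear S. Proof. by case: QS. Qed.
Let tri : triangle_free S. Proof. by case: QS. Qed.
Let pr : has_projections S. Proof. by case: QS. Qed.

(* The matrix A + (t + 1) I, where A is the collinearity matrix. *)
Definition joining (x y : point S) : nat := \sum_(l : line S) inc x l * inc y l.

Lemma joiningC x y : joining x y = joining y x.
Proof. by apply: eq_bigr => l _; rewrite mulnC. Qed.

Lemma joiningxx x : joining x x = t.+1.
Proof.
rewrite -(card_lines x) -sum1dep_card big_mkcond; apply: eq_bigr => l _.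
by rewrite mulnb andbb; case: inc.
Qed.

Lemma joining_on_line x y l : inc x l -> inc y l -> x != y -> joining x y = 1.
Proof.
move=> xl yl nxy; rewrite /joining (bigD1 l) //= xl yl big1 ?addn0 // => m nml.
have [xm|] := boolP (inc x m); have [ym|] := boolP (inc y m) => //.
by case/eqP: nml; apply: (lin xm ym).
Qed.

Lemma joining_noncollinear x y : ~~ collinear x y -> joining x y = 0.
Proof.
move=> ncxy; apply: big1 => l _; apply/eqP; rewrite mulnb eqb0.
by apply: contraNN ncxy => xyl; apply/existsP; exists l.
Qed.

Lemma joining_collinear x y : collinear x y -> x != y -> joining x y = 1.
Proof. by case/existsP=> l /andP [xl yl]; apply: joining_on_line xl yl. Qed.

Lemma sum_inc_line x : \sum_(l : line S) inc x l = t.+1.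
Proof.
rewrite -(card_lines x) -sum1dep_card [RHS]big_mkcond.
by apply: eq_bigr => l _; case: inc.
Qed.

Lemma sum_inc_point l : \sum_(x : point S) inc x l = s.+1.
Proof.
rewrite -(card_points l) -sum1dep_card [RHS]big_mkcond.
by apply: eq_bigr => x _; case: inc.
Qed.

(** For z off l only the projection of z contributes; for z on l, the point z itself gives t + 1 and
    each of the other s points gives 1. *)
Lemma sum_joining_on_line l z :
  \sum_(x : point S) inc x l * joining x z = 1 + inc z l * (s + t).
Proof.
have [zl|nzl] := boolP (inc z l).
  have := sum_inc_point l; rewrite (bigD1 z) //= zl => -[Es].
  rewrite (bigD1 z) //= zl joiningxx (eq_bigr (fun x => inc x l : nat)); first lia.
  by move=> x nxz; case: (boolP (inc x l)) => // xl; rewrite (joining_on_line xl zl).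
have [y [m [zm ym yl]]] := pr nzl.
have nyz : y != z by apply: contraNneq nzl => <-.
rewrite (bigD1 y) //= yl (joining_on_line ym zm nyz) big1 // => x nxy.
have [xl|] := boolP (inc x l) => //.
rewrite joining_noncollinear //; apply: contraNN nzl => /existsP [n /andP [xn zn]].
exact: (tri xl yl nxy ym zm zn xn).
Qed.

Lemma sum_joining x : \sum_(y : point S) joining x y = s.+1 * t.+1.
Proof.
rewrite exchange_big -(sum_inc_line x) big_distrr; apply: eq_bigr => l _ /=.
by rewrite -big_distrr /= sum_inc_point mulnC.
Qed.

(** With M the matrix [joining] and J the all-ones matrix, this is M^2 = (s + t) M + (t + 1) J.
    Hence M has only the eigenvalues 0 and s + t on vectors of sum zero. *)
Lemma sum_joining2 y z :
  \sum_(x : point S) joining x y * joining x z = t.+1 + (s + t) * joining y z.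
Proof.
under eq_bigr do rewrite [joining _ y]/joining big_distrl.
rewrite exchange_big /= -(sum_inc_line y) /joining big_distrr -big_split /=.
apply: eq_bigr => l _.
under eq_bigr => x _ do rewrite [inc x l * _]mulnC -mulnA.
by rewrite -big_distrr /= sum_joining_on_line mulnDr muln1 mulnA [in RHS]mulnC.
Qed.

(** Summing one row of the quadratic identity for [joining], whose row sums are all (s + 1)(t + 1),
    leaves a linear equation for the number of points. *)
Lemma card_point_gq (x : point S) : #|point S| = s.+1 * (s * t).+1.
Proof.
have : \sum_(z : point S) \sum_y joining y x * joining y z =
       \sum_(z : point S) (t.+1 + (s + t) * joining x z).
  by apply: eq_bigr => z _; rewrite sum_joining2.
rewrite exchange_big /=; under eq_bigr do rewrite -big_distrr /= sum_joining.
rewrite -big_distrl big_split /= -big_distrr /= sum_joining sum_nat_const.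
under eq_bigr do rewrite joiningC.
rewrite sum_joining => E.
apply/eqP; rewrite -(eqn_pmul2r (ltn0Sn t)); apply/eqP.
have Ev : #|point S| = #|(xpredT : pred (point S))| by apply: eq_card.
by rewrite Ev; apply: (@addIn ((s + t) * (s.+1 * t.+1))); rewrite -E; lia.
Qed.

(* The bound s - 1 for the second eigenvalue of the collinearity matrix, *)
(* tested on the indicator of P: a sum of squares is nonnegative.         *)
Lemma sum_joining_le (P : {set point S}) : 0 < s ->
  s.+1 * (\sum_(x in P) \sum_(y in P) joining x y) <=
  s.+1 * (s + t) * #|P| + #|P| ^ 2.
Proof.
move=> s_gt0; have [->|/set0Pn [x0 _]] := eqVneq P set0; first by rewrite big_set0 muln0.
set e := \sum_(x in P) _.
pose D x := \sum_(y in P) joining x y.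
have S1 : \sum_x D x = #|P| * (s.+1 * t.+1).
  rewrite exchange_big /=; under eq_bigr do (under eq_bigr do rewrite joiningC).
  by under eq_bigr do rewrite sum_joining; rewrite sum_nat_const.
have S2 : \sum_x D x * D x = #|P| * #|P| * t.+1 + (s + t) * e.
  under eq_bigr do rewrite big_distrl.
  rewrite exchange_big /= /e big_distrr /= -mulnA -sum_nat_const -big_split /=.
  apply: eq_bigr => y _; under eq_bigr do rewrite big_distrr.
  rewrite exchange_big /= big_distrr /= -sum_nat_const -big_split /=.
  by apply: eq_bigr => z _; rewrite sum_joining2.
have S3 : \sum_x (x \in P) * D x = e.
  rewrite /e [RHS]big_mkcond; apply: eq_bigr => x _; by case: (x \in P); rewrite ?mul1n.
have S4 : \sum_x (x \in P : nat) = #|P|.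
  by rewrite -sum1_card [RHS]big_mkcond; apply: eq_bigr => x _; case: (x \in P).
have Sv := card_point_gq x0; clearbody e.
(* The squares are those of a D(x) - b [x in P] - K with K = |P|, summed over x. This vector is s +
   1 times (M - (s + t) I) applied to the indicator of P, with its constant component removed: a
   multiple of the projection of the indicator to the kernel of M. Hiding the values of [a] and [b]
   keeps the pointwise inequality within reach of [lia]. *)
have [[a Ea] [b Eb]] : (exists a, a = s.+1) /\ (exists b, b = s.+1 * (s + t)) by split; eexists.
pose K := #|P|.
have : \sum_x (2 * a * b * ((x \in P) * D x) + 2 * a * K * D x) <=
    \sum_x (a ^ 2 * (D x * D x) + (b ^ 2 + 2 * b * K) * (x \in P) + K ^ 2).
  apply: leq_sum => x _; rewrite -!mulnn; have := nat_Cauchy (a * D x) (b * (x \in P) + K).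
  by case: (x \in P) => -[+ _]; rewrite -!mulnn; lia.
rewrite !big_split -!big_distrr /= S1 S2 S3 S4 sum_nat_const.
have -> : #|(xpredT : pred (point S))| = #|point S| by apply: eq_card.
rewrite Sv Ea Eb /K -!mulnn => H.
rewrite -(leq_pmul2l (_ : 0 < s.+1 * (s + t))) ?muln_gt0 ?addn_gt0 ?s_gt0 //.
clear -H; lia.
Qed.

(** Each row of [joining] restricted to X and Y sums to t + 1 + k, so [sum_joining_le] for the union
    reduces to (s - 1) k <= (s - 1)(s + 1); this is where s > 1 enters. *)
Lemma complete_bipartite_le (X Y : {set point S}) (k : nat) : 1 < s ->
  #|X| = k -> #|Y| = k -> [disjoint X & Y] ->
  pairwise_noncollinear X -> pairwise_noncollinear Y ->
  (forall x y, x \in X -> y \in Y -> collinear x y) -> k <= s.+1.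
Proof.
move=> s_gt1 cX cY dXY nX nY cXY.
have [-> // | k_gt0] := posnP k.
have same (Z : {set point S}) x : pairwise_noncollinear Z -> x \in Z ->
    \sum_(y in Z) joining x y = t.+1.
  move=> nZ xZ; rewrite (bigD1 x) //= joiningxx big1 ?addn0 // => y /andP [yZ nyx].
  by apply/joining_noncollinear/nZ; rewrite // eq_sym.
have cross (Z W : {set point S}) x : [disjoint Z & W] -> #|W| = k ->
    (forall x y, x \in Z -> y \in W -> collinear x y) ->
    x \in Z -> \sum_(y in W) joining x y = k.
  move=> dZW <- cZW xZ; rewrite -sum1_card; apply: eq_bigr => y yW.
  apply: joining_collinear; first exact: cZW.
  by apply: contraNneq (negbT (disjointFr dZW xZ)) => ->.
have cP : #|X :|: Y| = k + k.
  by rewrite cardsU (disjoint_setI0 dXY) cards0 subn0 cX cY.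
have sumU (F : point S -> nat) :
    \sum_(x in X :|: Y) F x = \sum_(x in X) F x + \sum_(x in Y) F x.
  by rewrite -bigU //; apply: eq_bigl => x; rewrite !inE.
have dYX : [disjoint Y & X] by rewrite disjoint_sym.
have cYX x y : x \in Y -> y \in X -> collinear x y.
  move=> xY yX; have /existsP [l] := cXY _ _ yX xY; rewrite andbC => yxl.
  by apply/existsP; exists l.
have := sum_joining_le (X :|: Y) (ltnW s_gt1); rewrite cP sumU.
rewrite (eq_bigr (fun=> t.+1 + k)); last by move=> x xX; rewrite sumU (same X) // (cross X Y).
rewrite [X in _ + X](eq_bigr (fun=> k + t.+1)); last first.
  by move=> x xY; rewrite sumU (same Y) // (cross Y X).
rewrite !sum_nat_const cX cY => H.
have {}H : s.+1 * (t.+1 + k) <= s.+1 * (s + t) + (k + k).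
  rewrite -(leq_pmul2l (_ : 0 < k + k)) ?addn_gt0 ?k_gt0 //; nia.
nia.
Qed.

Lemma card_line_gq (x : point S) : #|line S| = t.+1 * (s * t).+1.
Proof.
have : \sum_(l : line S) \sum_(y : point S) inc y l = #|line S| * s.+1.
  by under eq_bigr do rewrite sum_inc_point; rewrite sum_nat_const.
rewrite exchange_big /=; under eq_bigr do rewrite sum_inc_line.
rewrite sum_nat_const (card_point_gq x) => E.
apply/eqP; rewrite -(eqn_pmul2r (ltn0Sn s)) -E; apply/eqP; lia.
Qed.

(** A line has at most one point of O, so the |O| (t + 1) flags on O are at most as many as the (t +
    1)(st + 1) lines. *)
Lemma card_partial_ovoid_le (O : {set point S}) :
  pairwise_noncollinear O -> #|O| <= 1 + s * t.
Proof.
move=> nO; have [->|/set0Pn [x0 _]] := eqVneq O set0; first by rewrite cards0.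
rewrite -(leq_pmul2r (ltn0Sn t)) add1n [leqRHS]mulnC -(card_line_gq x0).
rewrite -sum_nat_const -sum1_card; under eq_bigr => x _ do rewrite -(sum_inc_line x).
rewrite exchange_big /=; apply: leq_sum => l _.
have [/existsP [x /andP [xO xl]]|/existsPn nxl] := boolP [exists x in O, inc x l].
  rewrite (bigD1 x) //= xl big1 // => y /andP [yO nyx].
  apply/eqP; rewrite eqb0; apply: contraNN (nO _ _ yO xO nyx) => yl.
  by apply/existsP; exists l; rewrite yl.
rewrite big1 // => x xO; apply/eqP; rewrite eqb0.
by have := nxl x; rewrite xO.
Qed.

End Collinearity.

(** * Grids *)

Lemma set_ord_bijection (T : finType) (A : {set T}) (n : nat) : #|A| = n.+1 ->
  exists (r : T -> 'I_n.+1) (v : 'I_n.+1 -> T),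
    [/\ forall i, v i \in A, cancel v r & {in A, cancel r v}].
Proof.
move=> cA; have /card_gt0P [x0 x0A] : 0 < #|A| by rewrite cA.
exists (fun x => cast_ord cA (enum_rank_in x0A x)).
exists (fun i => enum_val (cast_ord (esym cA) i)); split=> [i|i|x xA].
- exact: enum_valP.
- by rewrite enum_valK_in cast_ordKV.
- by rewrite cast_ordK enum_rankK_in.
Qed.

(** The coordinates of a point are the indices of its line in C and of its line outside C. *)
Lemma is_grid_of_partition (S : incidence_structure) (C : {set line S}) (s1 s2 : nat) :
    partial_linear S -> #|C| = s1.+1 -> #|~: C| = s2.+1 ->
    (forall l m, l \in C -> m \notin C -> exists2 x, inc x l & inc x m) ->
    (forall x, exists2 l, l \in C & inc x l) ->
    (forall x, exists2 l, l \notin C & inc x l) ->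
    (forall x l m, inc x l -> inc x m -> l \in C -> m \in C -> l = m) ->
    (forall x l m, inc x l -> inc x m -> l \notin C -> m \notin C -> l = m) ->
  is_grid s1 s2 S.
Proof.
move=> lin cC cD meet exC exD uC uD.
have [r1 [v1 [v1C v1K r1K]]] := set_ord_bijection cC.
have [r2 [v2 [v2D v2K r2K]]] := set_ord_bijection cD.
have {}v2D i : v2 i \notin C by have := v2D i; rewrite inE.
have {}r2K l : l \notin C -> v2 (r2 l) = l by move=> lC; apply: r2K; rewrite inE.
have /fin_all_exists [c cP] : forall x, exists l, l \in C /\ inc x l.
  by move=> x; have [l] := exC x; exists l.
have /fin_all_exists [d dP] : forall x, exists l, l \notin C /\ inc x l.
  by move=> x; have [l] := exD x; exists l.
have /fin_all_exists [q qP] : forall ij : 'I_s1.+1 * 'I_s2.+1,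
    exists x, inc x (v1 ij.1) /\ inc x (v2 ij.2).
  by move=> ij; have [x] := meet _ _ (v1C ij.1) (v2D ij.2); exists x.
have cE x l : inc x l -> l \in C -> c x = l.
  by move=> xl lC; have [cC' xc] := cP x; apply: (uC x).
have dE x l : inc x l -> l \notin C -> d x = l.
  by move=> xl lC; have [cC' xc] := dP x; apply: (uD x).
exists (fun x => (r1 (c x), r2 (d x))).
exists (fun l => if l \in C then inl (r1 l) else inr (r2 l)); split.
- exists q => [x|[i j]] /=.
    have [/= + +] := qP (r1 (c x), r2 (d x)); have [cC' xc] := cP x; have [dD xd] := dP x.
    rewrite r1K // r2K // => h1 h2; apply/eqP/negPn/negP => nq.
    by case/negP: dD; rewrite -(lin _ _ _ _ h1 xc h2 xd nq).
  have [/= h1 h2] := qP (i, j).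
  by rewrite (cE _ _ h1) // (dE _ _ h2) // v1K v2K.
- exists (fun l => match l with inl i => v1 i | inr j => v2 j end) => [l|[i|j]].
  + by case: ifPn => [/r1K | /r2K].
  + by rewrite v1C v1K.
  + by rewrite (negbTE (v2D j)) v2K.
- move=> x l; have [cC' xc] := cP x; have [dD xd] := dP x.
  case: ifPn => lC /=.
    apply/eqP/idP => [/(congr1 v1)|xl]; last by rewrite (cE x l).
    by rewrite !r1K // => <-.
  apply/eqP/idP => [/(congr1 v2)|xl]; last by rewrite (dE x l).
  by rewrite !r2K // => <-.
Qed.

(** In [dual S] this relation says that two points are equal or noncollinear. *)
Definition parallel (S : incidence_structure) (l m : line S) : bool :=
  (l == m) || ~~ [exists x : point S, inc x l && inc x m].

Lemma parallelC (S : incidence_structure) (l m : line S) : parallel l m = parallel m l.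
Proof.
by rewrite /parallel eq_sym; congr (_ || ~~ _); apply: eq_existsb => x; rewrite andbC.
Qed.

Lemma parallelxx (S : incidence_structure) (l : line S) : parallel l l.
Proof. by rewrite /parallel eqxx. Qed.

Lemma parallel_eq (S : incidence_structure) (x : point S) (l m : line S) :
  inc x l -> inc x m -> parallel l m -> l = m.
Proof. by move=> xl xm /orP [/eqP//|/existsP []]; exists x; rewrite xl. Qed.

Lemma nparallelP (S : incidence_structure) (l m : line S) : ~~ parallel l m ->
  l != m /\ exists2 x, inc x l & inc x m.
Proof.
by rewrite negb_or negbK => /andP [nlm /existsP [x /andP [xl xm]]]; split=> //; exists x.
Qed.

Lemma card_le2 (T : finType) (A : {set T}) (a b c : T) : #|A| <= 2 ->
  a \in A -> b \in A -> c \in A -> a != b -> c != a -> c = b.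
Proof.
move=> cA aA bA cA' nab nca; apply/eqP/negPn/negP => ncb.
have /subset_leq_card : c |: [set a; b] \subset A.
  by apply/subsetP => x; rewrite !inE => /or3P [] /eqP ->.
by rewrite cardsU1 cards2 !inE negb_or nca ncb nab => /leq_trans /(_ cA).
Qed.

(** * Parallel classes when every point is on two lines *)

Section TwoLines.

Variables (S : incidence_structure).
Hypothesis QS : quadrangular S.
Hypothesis two_lines : forall x : point S, #|[set l : line S | inc x l]| = 2.

Let lin : partial_linear S. Proof. by case: QS. Qed.
Let tri : triangle_free S. Proof. by case: QS. Qed.
Let pr : has_projections S. Proof. by case: QS. Qed.

Let third_line (x : point S) (l m n : line S) :
  inc x l -> inc x m -> inc x n -> l != m -> n != l -> n = m.
Proof.
by move=> xl xm xn; apply: (card_le2 (eq_leq (two_lines x))); rewrite inE.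
Qed.

(** If m and n met in x off l, the line projecting x to l would be m or n, the only lines on x, and
    would meet l. *)
Lemma parallel_trans (l m n : line S) : parallel m l -> parallel l n -> parallel m n.
Proof.
move=> ml ln; apply/negPn/negP => /nparallelP [nmn [x xm xn]].
have [xl|nxl] := boolP (inc x l).
  by rewrite (parallel_eq xm xl ml) (parallel_eq xl xn ln) eqxx in nmn.
have [y [k [xk yk yl]]] := pr nxl.
have Ek : k = m \/ k = n.
  by have [->|nkm] := eqVneq k m; [left|right; apply: third_line xm xn xk nmn nkm].
rewrite parallelC in ml; suff El : k = l by rewrite -El xk in nxl.
by case: Ek yk => -> yk; rewrite (parallel_eq yl yk).
Qed.

(** Three mutually meeting lines would form a triangle, hence pass through one point, which is on
    only two lines. *)
Lemma nparallel_trans (l m n : line S) :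
  ~~ parallel l m -> ~~ parallel l n -> parallel m n.
Proof.
move=> /nparallelP [nlm [y yl ym]] /nparallelP [nln [z zl zn]].
apply/negPn/negP => /nparallelP [nmn [x xm xn]].
suff [u [ul um un]] : exists u, [/\ inc u l, inc u m & inc u n].
  by rewrite (third_line ul um un nlm) ?eqxx // eq_sym in nmn *.
have [Eyz|nyz] := eqVneq y z; first by exists y; split=> //; rewrite Eyz.
by exists x; split=> //; apply: (tri yl zl nyz zn xn xm ym).
Qed.

(** Parallelism is an equivalence with at most two classes; comparison with a reference line l
    reduces it to booleans. *)
Lemma parallel_class (l m n : line S) : parallel m n = (parallel l m == parallel l n).
Proof.
have [lm|lm] := boolP (parallel l m); have [ln|ln] := boolP (parallel l n).
- by rewrite (@parallel_trans l) // parallelC.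
- by apply: contraNF ln; apply: parallel_trans.
- by apply: contraNF lm => mn; apply: parallel_trans ln _; rewrite parallelC.
- by rewrite (@nparallel_trans l).
Qed.

(** Sending a point of l to its other line is a bijection onto the lines that meet l in one
    point. *)
Lemma card_nparallel (l : line S) :
  #|[set m | ~~ parallel l m]| = #|[set x : point S | inc x l]|.
Proof.
have /fin_all_exists [d dP] : forall x : point S,
    exists m, inc x m && (m != l).
  move=> x; have [|m mx nlm] := @exists_other _ [set m : line S | inc x m] l.
    by rewrite two_lines.
  by exists m; rewrite eq_sym nlm andbT; rewrite inE in mx.
rewrite -(card_in_imset (f := d)) => [|x y]; last first.
  rewrite !inE => xl yl E; apply/eqP/negPn/negP => nxy.
  have /andP [xd] := dP x; have /andP [yd _] := dP y; rewrite -E in yd.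
  by rewrite (lin xd yd xl yl nxy) eqxx.
congr #|pred_of_set _|; apply/setP => m; rewrite inE.
apply/idP/imsetP => [/nparallelP [nlm [x xl xm]]|[x xl ->]].
  exists x; first by rewrite inE.
  have /andP [xd nd] := dP x; symmetry; apply: third_line xl xm xd nlm nd.
have /andP [xd nd] := dP x; rewrite inE in xl.
by apply: contraNN nd => /(parallel_eq xl xd) ->.
Qed.

(** The class of l consists of the lines meeting m, so its size is the number of points on m; hence
    the order [b a] of the parameters. *)
Lemma two_lines_grid (l m : line S) (a b : nat) : ~~ parallel l m ->
  #|[set x : point S | inc x l]| = a.+1 -> #|[set x : point S | inc x m]| = b.+1 ->
  is_grid b a S.
Proof.
move=> nlm cl cm.
have classE k : parallel l k = ~~ parallel m k.
  by rewrite (parallel_class m l k) [parallel m l]parallelC (negbTE nlm); case: parallel.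
have lines x : exists k n : line S, [/\ inc x k, inc x n, parallel l k & ~~ parallel l n].
  have /cards2P [k [n [nkn E]]] := introT eqP (two_lines x).
  have xk : inc x k by have := set21 k n; rewrite -E inE.
  have xn : inc x n by have := set22 k n; rewrite -E inE.
  have : ~~ parallel k n by apply: contraNN nkn => /(parallel_eq xk xn) ->.
  rewrite (parallel_class l k n).
  have [lk|lk] := boolP (parallel l k); have [ln|ln] := boolP (parallel l n) => // _.
    by exists k, n.
  by exists n, k.
apply: (@is_grid_of_partition _ [set k | parallel l k]) => //.
- rewrite -cm -card_nparallel; congr #|pred_of_set _|; apply/setP => k.
  by rewrite !inE classE.
- rewrite -cl -card_nparallel; congr #|pred_of_set _|; apply/setP => k.
  by rewrite !inE.
- move=> k n; rewrite !inE => lk ln.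
  have : ~~ parallel k n by rewrite (parallel_class l) lk (negbTE ln).
  by case/nparallelP=> _ [x]; exists x.
- by move=> x; have [k [n [xk xn lk ln]]] := lines x; exists k; rewrite ?inE.
- by move=> x; have [k [n [xk xn lk ln]]] := lines x; exists n; rewrite ?inE.
- move=> x k n xk xn; rewrite !inE => lk ln; apply: (parallel_eq xk xn).
  by rewrite (parallel_class l) lk ln.
- move=> x k n xk xn; rewrite !inE => lk ln; apply: (parallel_eq xk xn).
  by rewrite (parallel_class l) (negbTE lk) (negbTE ln).
Qed.

End TwoLines.

(** * Closed substructures *)

Definition closed_substructure (S : incidence_structure)
    (A : {set point S}) (B : {set line S}) : Prop :=
  [/\ forall x y l, x \in A -> y \in A -> x != y -> inc x l -> inc y l -> l \in B,
      forall l m x, l \in B -> m \in B -> l != m -> inc x l -> inc x m -> x \in A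
    & forall x l, x \in A -> l \in B -> ~~ inc x l ->
        exists y m, [/\ y \in A, m \in B & [/\ inc x m, inc y m & inc y l]]].

Lemma closed_substructure_dual (S : incidence_structure)
    (A : {set point S}) (B : {set line S}) :
  closed_substructure A B -> @closed_substructure (dual S) B A.
Proof.
case=> c1 c2 c3; split=> [l m x|x y l|l x lB xA nxl].
- by move=> /= lB mB nlm xl xm; apply: c2 nlm xl xm.
- by move=> /= lB mB nlm xl xm; apply: c1 nlm xl xm.
have [y [m [yA mB [xm ym yl]]]] := c3 _ _ xA lB nxl.
by exists m, y; split.
Qed.

Section Closed.

Variables (S : incidence_structure) (A : {set point S}) (B : {set line S}).
Hypotheses (QS : quadrangular S) (AB : closed_substructure A B).

Lemma quadrangular_sub : quadrangular (substructure A B).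
Proof.
have [lin tri pr] := QS; have [_ _ c3] := AB; split.
- by move=> x y l m xl yl xm ym nxy; apply/val_inj/(lin _ _ _ _ xl yl xm ym).
- move=> x y z l m n xl yl nxy; exact: (tri (val x) (val y) (val z)).
- move=> [x xA] [l lB] /= nxl.
  have [y [m [yA mB [xm ym yl]]]] := c3 _ _ xA lB nxl.
  by exists (exist _ y yA), (exist _ m mB).
Qed.

Lemma card_sub_points (l : line (substructure A B)) :
  #|[set x : point (substructure A B) | inc x l]| = #|[set x in A | inc x (val l)]|.
Proof.
rewrite -(card_imset _ val_inj); congr #|pred_of_set _|; apply/setP => x.
rewrite inE; apply/imsetP/andP => [[y + ->]|[xA xl]].
  by rewrite inE => yl; split=> //; apply: valP.
by exists (exist _ x xA); rewrite ?inE.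
Qed.

Lemma card_sub_lines (x : point (substructure A B)) :
  #|[set l : line (substructure A B) | inc x l]| = #|[set l in B | inc (val x) l]|.
Proof.
rewrite -(card_imset _ val_inj); congr #|pred_of_set _|; apply/setP => l.
rewrite inE; apply/imsetP/andP => [[m + ->]|[lB xl]].
  by rewrite inE => yl; split=> //; apply: valP.
by exists (exist _ l lB); rewrite ?inE.
Qed.

(** Two distinct lines of B that meet in S meet in a point of A, so parallelism may be computed in
    S. *)
Lemma parallel_sub (l m : line (substructure A B)) :
  parallel l m = parallel (val l) (val m).
Proof.
have [_ c2 _] := AB; rewrite /parallel.
have [-> | nlm] := eqVneq l m; first by rewrite eqxx.
have nlm' : val l != val m by [].
rewrite (negbTE nlm') /=; congr (~~ _).
apply/existsP/existsP => [[x xlm]|[x /andP [xl xm]]]; first by exists (val x).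
have xA := c2 _ _ _ (valP l) (valP m) nlm' xl xm.
by exists (exist _ x xA); apply/andP.
Qed.

(** Projection from l to m is injective: two points of l with the same image would form a triangle
    with it, putting that image on l. *)
Lemma card_disjoint_lines_le (l m : line S) : l \in B -> m \in B ->
  l != m -> parallel l m -> #|[set x in A | inc x l]| <= #|[set x in A | inc x m]|.
Proof.
have [lin tri _] := QS; have [_ _ c3] := AB.
move=> lB mB nlm /orP [/eqP E|/existsPn nmeet]; first by rewrite E eqxx in nlm.
(* The default [x] is never taken for a point of A on l, since its projection to m exists in A. *)
pose f x := odflt x [pick y | [&& y \in A, inc y m & collinear x y]].
have fP x : x \in A -> inc x l -> [/\ f x \in A, inc (f x) m & collinear x (f x)].
  move=> xA xl; rewrite /f; case: pickP => [y /and3P []//|no] /=.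
  have nxm : ~~ inc x m by have := nmeet x; rewrite xl.
  have [y [n [yA nB [xn yn ym]]]] := c3 _ _ xA mB nxm.
  by have := no y; rewrite yA ym /= => /existsP []; exists n; rewrite xn.
rewrite -(card_in_imset (f := f)) => [|x y]; last first.
  rewrite !inE => /andP [xA xl] /andP [yA yl] E.
  have [fA fm /existsP [k /andP [xk fk]]] := fP x xA xl.
  have [_ _ /existsP [n /andP [yn]]] := fP y yA yl; rewrite -E => fn.
  apply/eqP/negPn/negP => nxy.
  by have := nmeet (f x); rewrite fm (tri _ _ _ _ _ _ xl yl nxy yn fn fk xk).
apply/subset_leq_card/subsetP => _ /imsetP [x + ->]; rewrite !inE => /andP [xA xl].
by have [-> ->] := fP x xA xl.
Qed.

Lemma card_disjoint_lines (l m : line S) : l \in B -> m \in B ->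
  parallel l m -> #|[set x in A | inc x l]| = #|[set x in A | inc x m]|.
Proof.
move=> lB mB plm; have [-> //|nlm] := eqVneq l m.
by apply/eqP; rewrite eqn_leq !card_disjoint_lines_le // ?(eq_sym m) // parallelC.
Qed.

(** Disjoint lines have equally many points of A, so for l and m meeting in x a line n disjoint from
    both is sought: take a third line k on x, a second point w on k, and another line n on w. A
    point common to n and to l or m would complete a triangle. *)
Lemma card_lines_const : (forall l, l \in B -> 2 <= #|[set x in A | inc x l]|) ->
  (forall x, x \in A -> 3 <= #|[set l in B | inc x l]|) ->
  {in B &, forall l m, #|[set x in A | inc x l]| = #|[set x in A | inc x m]|}.
Proof.
have [lin tri pr] := QS; have [c1 c2 c3] := AB.
move=> points2 lines3 l m lB mB.
have [plm|/nparallelP [nlm [x xl xm]]] := boolP (parallel l m).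
  exact: card_disjoint_lines.
have xA := c2 _ _ _ lB mB nlm xl xm.
have [k [kB xk nkl nkm]] : exists k, [/\ k \in B, inc x k, k != l & k != m].
  have : ~~ ([set k in B | inc x k] \subset [set l; m]).
    by apply/negP => /subset_leq_card; rewrite leqNgt cards2 nlm lines3.
  case/subsetPn=> k; rewrite !inE negb_or => /andP [kB xk] /andP [nkl nkm].
  by exists k.
have [w] := exists_other x (points2 _ kB); rewrite !inE => /andP [wA wk] nxw.
have [n] := exists_other k (ltnW (lines3 _ wA)); rewrite !inE => /andP [nB wn] nkn.
have par j : j \in B -> inc x j -> k != j -> parallel j n.
  move=> jB xj nkj; apply/orP; right; apply/existsPn => u; apply/negP => /andP [uj un].
  have [Eux|nux] := eqVneq x u.
    by rewrite (lin _ _ _ _ xk wk _ wn nxw) ?eqxx // Eux in nkn.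
  have wj := tri _ _ _ _ _ _ xj uj nux un wn wk xk.
  by rewrite (lin _ _ _ _ xk wk xj wj nxw) eqxx in nkj.
rewrite (card_disjoint_lines lB nB) 1?(card_disjoint_lines mB nB) //.
  by apply: par => //; rewrite eq_sym.
by apply: par => //; rewrite eq_sym.
Qed.

Lemma sub_generalized_quadrangle (p : point S) (s' t' : nat) :
  p \in A -> 0 < s' -> 0 < t' ->
  (forall l, l \in B -> #|[set x in A | inc x l]| = s'.+1) ->
  (forall x, x \in A -> #|[set l in B | inc x l]| = t'.+1) ->
  generalized_quadrangle s' t' (substructure A B).
Proof.
move=> pA s'0 t'0 cA cB; pose x0 : point (substructure A B) := exist _ p pA.
apply: (quadrangular_gq x0 quadrangular_sub) => // [l|x].
  by rewrite card_sub_points; apply: cA; apply: valP.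
by rewrite card_sub_lines; apply: cB; apply: valP.
Qed.

Hypothesis two_lines : forall x, x \in A -> #|[set l in B | inc x l]| = 2.

Let two_lines_sub (x : point (substructure A B)) :
  #|[set l : line (substructure A B) | inc x l]| = 2.
Proof. by rewrite card_sub_lines; apply: two_lines; apply: valP. Qed.

Lemma parallel_class_sub (l m n : line S) : l \in B -> m \in B -> n \in B ->
  parallel m n = (parallel l m == parallel l n).
Proof.
move=> lB mB nB.
have := parallel_class quadrangular_sub two_lines_sub
  (exist _ l lB) (exist _ m mB) (exist _ n nB).
by rewrite !parallel_sub.
Qed.

Lemma card_nparallel_sub (l : line S) : l \in B ->
  #|[set m in B | ~~ parallel l m]| = #|[set x in A | inc x l]|.
Proof.
move=> lB.
have := card_nparallel quadrangular_sub two_lines_sub (exist _ l lB).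
rewrite card_sub_points => /= <-; rewrite -[RHS](card_imset _ val_inj).
congr #|pred_of_set _|; apply/setP => m.
rewrite inE; apply/andP/imsetP => [[mB nlm]|[k + ->]].
  by exists (exist _ m mB); rewrite // inE parallel_sub.
by rewrite inE parallel_sub => nlk; split=> //; apply: valP.
Qed.

Lemma sub_grid (l m : line S) (a b : nat) : l \in B -> m \in B -> ~~ parallel l m ->
  #|[set x in A | inc x l]| = a.+1 -> #|[set x in A | inc x m]| = b.+1 ->
  is_grid b a (substructure A B).
Proof.
move=> lB mB nlm cl cm.
apply: (two_lines_grid quadrangular_sub two_lines_sub
  (l := exist _ l lB) (m := exist _ m mB)); rewrite ?card_sub_points //.
by rewrite parallel_sub.
Qed.

End Closed.

(** * Regular groups on closed substructures *)

Lemma is_dual_grid_of_dual (S : incidence_structure) (t1 t2 : nat) :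
  is_grid t2 t1 (dual S) -> is_dual_grid t1 t2 S.
Proof. by case=> f [g [bf bg fg]]; exists g, f; split=> // x l; apply: fg. Qed.

Section RegularSubstructure.

Variables (s t : nat) (S : incidence_structure).
Hypothesis QS : quadrangular S.
Hypothesis card_points : forall l : line S, #|[set x : point S | inc x l]| = s.+1.
Hypothesis card_lines : forall x : point S, #|[set l : line S | inc x l]| = t.+1.
Variables (A : {set point S}) (B : {set line S}) (H : {group biperm S}) (p : point S).
Hypothesis AB : closed_substructure A B.
Hypothesis autH : H \subset automorphisms S.
Hypothesis freeH : forall x, {in H &, injective (fun h => pt x h)}.
Hypothesis AH : forall h x, h \in H -> x \in A -> pt x h \in A.
Hypothesis BH : forall (h : biperm S) (l : line S), h \in H -> l \in B -> h.2 l \in B.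
Hypothesis pA : p \in A.
Hypothesis transH : forall x, x \in A -> exists2 h, h \in H & pt p h = x.

Let lin : partial_linear S. Proof. by case: QS. Qed.
Let tri : triangle_free S. Proof. by case: QS. Qed.
Let c1 x y l : x \in A -> y \in A -> x != y -> inc x l -> inc y l -> l \in B.
Proof. by case: AB => c1 _ _; apply: c1. Qed.
Let c3 x l : x \in A -> l \in B -> ~~ inc x l ->
        exists y m, [/\ y \in A, m \in B & [/\ inc x m, inc y m & inc y l]].
Proof. by case: AB => _ _ c3; apply: c3. Qed.

Let incH (h : biperm S) x l : h \in H -> inc (pt x h) (h.2 l) = inc x l.
Proof.
by move=> /(subsetP autH); rewrite inE => /forallP /(_ x) /forallP /(_ l) /eqP.
Qed.

Let lineM (g h : biperm S) (l : line S) : (g * h)%g.2 l = h.2 (g.2 l).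
Proof. exact: permM. Qed.

Let lineK (h : biperm S) (l : line S) : h^-1%g.2 (h.2 l) = l.
Proof. exact: permK. Qed.

Let lineKV (h : biperm S) (l : line S) : h.2 (h^-1%g.2 l) = l.
Proof. exact: permKV. Qed.

Let line1 (l : line S) : (1%g : biperm S).2 l = l.
Proof. exact: perm1. Qed.

Let ptK (h : biperm S) (x : point S) : pt (pt x h) h^-1%g = x.
Proof. exact: permK. Qed.

Let ptKV (h : biperm S) (x : point S) : pt (pt x h^-1%g) h = x.
Proof. exact: permKV. Qed.

Let incHV (h : biperm S) x l : h \in H -> inc (pt x h^-1%g) l = inc x (h.2 l).
Proof. by move=> hH; rewrite -(incH _ l hH) ptKV. Qed.

Let parallelH (h : biperm S) (l m : line S) : h \in H ->
  parallel (h.2 l) (h.2 m) = parallel l m.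
Proof.
move=> hH; rewrite /parallel (inj_eq perm_inj); congr (_ || ~~ _).
apply/existsP/existsP => [[x xlm]|[x xlm]]; last by exists (pt x h); rewrite !incH.
by exists (pt x h^-1%g); rewrite !incHV.
Qed.

Lemma card_points_subset (D : pred (point S)) :
  #|[set h in H | D (pt p h)]| = #|[set x in A | D x]|.
Proof.
rewrite -(card_in_imset (f := fun h : biperm S => pt p h)); last first.
  by move=> h k; rewrite !inE => /andP [hH _] /andP [kH _]; apply: freeH.
congr #|pred_of_set _|; apply/setP => x; rewrite inE.
apply/imsetP/andP => [[h]|[xA Dx]].
  by rewrite inE => /andP [hH Dh] ->; rewrite AH.
by have [h hH Eh] := transH xA; exists h; rewrite ?inE ?hH Eh.
Qed.

Lemma card_regular : #|H| = #|A|.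
Proof.
have := card_points_subset xpredT; rewrite (_ : [set h in H | true] = H :> {set _}).
  by move=> ->; congr #|pred_of_set _|; apply/setP => x; rewrite inE andbT.
by apply/setP => h; rewrite inE andbT.
Qed.

Lemma points_of_regular : points_of p H = A.
Proof.
apply/setP => x; apply/imsetP/idP => [[h hH ->]|/transH [h hH <-]]; first exact: AH.
by exists h.
Qed.

(** Y acts on the s + 1 points of l with trivial point stabilizers, so every orbit has size |Y|. *)
Lemma dvdn_card_stabilizer (Y : {group biperm S}) (l : line S) :
  Y \subset H -> (forall y, y \in Y -> y.2 l = l) -> #|Y| %| s.+1.
Proof.
move=> YH Yl; rewrite -(card_points l).
pose pt_action := TotalAction (@perm1 (point S) : forall x : point S, pt x 1%g = x) (@ptM S).
set L := [set x | inc x l].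
have acts : [acts Y, on L | pt_action].
  apply/actsP => y yY x; rewrite !inE /= -{1}(Yl _ yY) incH //.
  exact: (subsetP YH).
rewrite (card_uniform_partition (n := #|Y|) _ (orbit_partition acts)) ?dvdn_mull //.
move=> _ /imsetP [x _ ->]; rewrite -(card_orbit_stab pt_action Y x).
rewrite (_ : 'C_Y[x | pt_action]%g = 1%g) ?cards1 ?muln1 //.
apply/trivgP/subsetP => y; rewrite inE => /andP [yY /astab1P Ey]; rewrite inE.
apply/eqP/(freeH (x := x)); rewrite ?group1 ?(subsetP YH) //.
by rewrite [pt x 1%g]perm1.
Qed.

Let moveH x y : x \in A -> y \in A -> exists2 h, h \in H & pt x h = y.
Proof.
move=> /transH [g gH <-] /transH [h hH <-].
by exists (g^-1 * h)%g; rewrite ?groupM ?groupV // ptM ptK.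
Qed.

Lemma card_lines_homogeneous x : x \in A ->
  #|[set l in B | inc x l]| = #|[set l in B | inc p l]|.
Proof.
move=> /transH [h hH <-].
rewrite -(card_imset [set l in B | inc p l] (@perm_inj _ h.2)).
congr #|pred_of_set _|; apply/setP => l; rewrite inE.
apply/andP/imsetP => [[lB pl]|[m + ->]].
  exists (h^-1%g.2 l); rewrite ?lineKV // inE BH ?groupV //=.
  by rewrite -[p](ptK h) incH ?groupV.
by rewrite inE => /andP [mB pm]; rewrite BH ?incH.
Qed.

(** By transitivity no point of A is on a line of B. A line of B would carry p or its projection,
    and the line joining two collinear points of A would be in B. *)
Lemma noncollinear_case :
  [set l in B | inc p l] = set0 -> partial_ovoid A B.
Proof.
move=> L0; have noline x l : x \in A -> l \in B -> ~~ inc x l.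
  move=> xA lB; apply/negP => xl; have := card_lines_homogeneous xA.
  by rewrite L0 cards0 => /eqP; rewrite cards_eq0 => /eqP /setP /(_ l); rewrite !inE lB xl.
split=> [|x y xA yA nxy].
  apply/setP => l; rewrite inE; apply/negbTE/negP => lB.
  have [y [m [yA mB [_ ym _]]]] := c3 pA lB (noline _ _ pA lB).
  by have := noline _ _ yA mB; rewrite ym.
apply/existsP => -[l /andP [xl yl]].
by have := noline _ _ xA (c1 xA yA nxy xl yl); rewrite xl.
Qed.

(** Two points of A determine the common line, and their images are again in A, so H stabilizes that
    line. *)
Lemma common_line_case : 1 < #|H| -> on_common_line A ->  #|H| %| 1 + s.
Proof.
rewrite card_regular => /card_gt1P [x [y [xA yA nxy]]] [l lA].
rewrite add1n; rewrite -card_regular; apply: (dvdn_card_stabilizer (l := l)) => // h hH.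
have nh : pt x h != pt y h by rewrite (inj_eq perm_inj).
apply: (lin (x := pt x h) (y := pt y h)); rewrite ?incH ?lA //; exact: AH.
Qed.

Lemma one_line_case : #|[set l in B | inc p l]| = 1 -> on_common_line A.
Proof.
move=> L1; have one x l m : x \in A -> l \in B -> m \in B -> inc x l -> inc x m -> l = m.
  move=> xA lB mB xl xm; have := card_lines_homogeneous xA.
  rewrite L1 => /eqP /cards1P [k /setP E].
  by have := E l; have := E m; rewrite !inE lB mB xl xm /= => /esym /eqP -> /esym /eqP.
have /card_gt0P [l] : 0 < #|[set l in B | inc p l]| by rewrite L1.
rewrite inE => /andP [lB pl]; exists l => x xA; apply/negPn/negP => nxl.
have [y [m [yA mB [xm ym yl]]]] := c3 xA lB nxl.
by rewrite (one y l m) // xm in nxl.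
Qed.

(** If x is the only point of A on a line of B, every point of A projects to x, hence is collinear
    with x. Moving x by H gives a second such point y, and the absence of triangles forces A onto
    the line xy. *)
Lemma two_points_case : 1 < #|H| -> 1 < #|[set l in B | inc p l]| ->
  on_common_line A \/ (forall l, l \in B -> 1 < #|[set x in A | inc x l]|).
Proof.
rewrite card_regular => A1 L1.
have [/forallP all2|/forallPn [l]] :=
  boolP [forall l, (l \in B) ==> (1 < #|[set x in A | inc x l]|)].
  by right=> l lB; apply: (implyP (all2 l)).
rewrite negb_imply -leqNgt => /andP [lB few]; left.
have single x (m : line S) z : x \in A -> inc x m -> m \in B ->
    #|[set y in A | inc y m]| <= 1 -> z \in A -> collinear z x.
  move=> xA xm mB /card_le1_eqP m1 zA.
  have [zm|nzm] := boolP (inc z m); first by apply/existsP; exists m; rewrite zm.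
  have [y [n [yA nB [zn yn ym]]]] := c3 zA mB nzm.
  have Exy : x = y by apply: m1; rewrite inE ?xA ?yA.
  by apply/existsP; exists n; rewrite zn Exy.
have [x xA xl] : exists2 x, x \in A & inc x l.
  have [pl|/(c3 pA lB) [y [n [yA _ [_ _ yl]]]]] := boolP (inc p l); first by exists p.
  by exists y.
have [y yA nxy] := exists_other x A1.
have [h hH Eh] := moveH xA yA.
have colx := single x l _ xA xl lB few.
have coly z : z \in A -> collinear z y.
  apply: (single y (h.2 l)); rewrite ?BH -?Eh ?incH //; first by rewrite Eh.
  apply: leq_trans few.
  rewrite -(card_imset [set y in A | inc y l] (@perm_inj _ h.1)).
  apply/subset_leq_card/subsetP => w; rewrite inE => /andP [wA whl].
  apply/imsetP; exists (pt w h^-1%g); last by rewrite -/(pt _ h) ptKV.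
  by rewrite inE AH ?groupV // incHV.
have /existsP [m /andP [ym xm]] := colx y yA.
exists m => z zA.
have /existsP [n /andP [zn xn]] := colx z zA; have /existsP [k /andP [zk yk]] := coly z zA.
exact: (tri xm ym nxy yk zk zn xn).
Qed.

Lemma card_line_image (h : biperm S) (l : line S) : h \in H ->
  #|[set x in A | inc x (h.2 l)]| = #|[set x in A | inc x l]|.
Proof.
move=> hH; rewrite -[RHS](card_imset _ (@perm_inj _ h.1)).
congr #|pred_of_set _|; apply/setP => x; rewrite inE.
apply/andP/imsetP => [[xA xhl]|[y + ->]].
  exists (pt x h^-1%g); last by rewrite -/(pt _ h) ptKV.
  by rewrite inE AH ?groupV // incHV.
by rewrite inE => /andP [yA yl]; rewrite -/(pt y h) AH ?incH.
Qed.

Lemma line_stabilizer_group_set (l : line S) : group_set [set h in H | h.2 l == l].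
Proof.
apply/group_setP; split=> [|h k]; first by rewrite inE group1 line1 eqxx.
rewrite !inE => /andP [hH /eqP hl] /andP [kH /eqP kl].
by rewrite groupM // lineM hl kl eqxx.
Qed.

Definition line_stabilizer (l : line S) : {group biperm S} :=
  Group (line_stabilizer_group_set l).

Lemma line_stabilizer_sub (l : line S) : line_stabilizer l \subset H.
Proof. by apply/subsetP => h; rewrite inE => /andP []. Qed.

(** If h takes p to a point of l, then l and its image meet there; being parallel they coincide. So
    the stabilizer of l corresponds to the points of A on l. *)
Lemma parallel_stabilizer (l : line S) : inc p l ->
  (forall h, h \in H -> parallel l (h.2 l)) ->
  [/\ #|line_stabilizer l| = #|[set x in A | inc x l]|, #|line_stabilizer l| %| s.+1
    & on_common_line (points_of p (line_stabilizer l))].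
Proof.
move=> pl parl; split.
- rewrite -card_points_subset; congr #|pred_of_set _|; apply/setP => h; rewrite !inE.
  have [hH|//] := boolP (h \in H) => /=.
  apply/eqP/idP => [<-|phl]; first by rewrite incH.
  by symmetry; apply: (parallel_eq phl); rewrite ?incH ?parl.
- apply: (dvdn_card_stabilizer (l := l) (line_stabilizer_sub l)) => y.
  by rewrite inE => /andP [_ /eqP].
- exists l => _ /imsetP [h + ->]; rewrite inE => /andP [hH /eqP <-].
  by rewrite incH.
Qed.

(** * Two lines on each point: grids *)

Section Grid.

Variables l1 l2 : line S.
Hypotheses (nl12 : l1 != l2) (lines_p : [set l in B | inc p l] = [set l1; l2]).
Hypothesis points2 : forall l, l \in B -> 1 < #|[set x in A | inc x l]|.

Let two_lines x : x \in A -> #|[set l in B | inc x l]| = 2.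
Proof. by move=> xA; rewrite card_lines_homogeneous // lines_p cards2 nl12. Qed.

Let l1P : l1 \in B /\ inc p l1.
Proof. by have := set21 l1 l2; rewrite -lines_p inE => /andP. Qed.
Let l2P : l2 \in B /\ inc p l2.
Proof. by have := set22 l1 l2; rewrite -lines_p inE => /andP. Qed.
Let l1B := proj1 l1P. Let pl1 := proj2 l1P. Let l2B := proj1 l2P. Let pl2 := proj2 l2P.

Let npar12 : ~~ parallel l1 l2.
Proof. by apply: contraNN nl12 => /(parallel_eq pl1 pl2) ->. Qed.

Let parE l m n : l \in B -> m \in B -> n \in B ->
  parallel m n = (parallel l m == parallel l n).
Proof. exact: (parallel_class_sub QS AB two_lines). Qed.

Let lines_at (h : biperm S) (m : line S) : h \in H -> m \in B -> inc (pt p h) m ->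
  h.2 l1 = m \/ h.2 l2 = m.
Proof.
move=> hH mB phm; have /setP /(_ (h^-1%g.2 m)) := lines_p.
rewrite !inE BH ?groupV //= -(incH _ _ hH) lineKV phm => /esym /orP [] /eqP <-;
  rewrite lineKV; by [left|right].
Qed.

Let meet l m : l \in B -> m \in B -> ~~ parallel l m ->
  exists x, [/\ x \in A, inc x l & inc x m].
Proof.
move=> lB mB /nparallelP [nlm [x xl xm]]; exists x; split=> //.
by case: AB => _ c2 _; apply: (c2 l m).
Qed.

Lemma parallel_grid_case : (forall h, h \in H -> parallel l1 (h.2 l1)) ->
  exists s1 s2 : nat, is_grid s1 s2 (substructure A B) /\
    exists Y1 Y2 : {group biperm S},
      [/\ Y1 \subset H, Y2 \subset H & H = (Y1 * Y2)%g :> {set biperm S}] /\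
      [/\ #|Y1| = s1 + 1, s1 + 1 %| s + 1 & on_common_line (points_of p Y1)] /\
      [/\ #|Y2| = s2 + 1, s2 + 1 %| s + 1 & on_common_line (points_of p Y2)].
Proof.
move=> par1.
have par2 h : h \in H -> parallel l2 (h.2 l2).
  move=> hH; have hl1B := BH hH l1B; have hl2B := BH hH l2B.
  have nh : ~~ parallel (h.2 l1) (h.2 l2) by rewrite parallelH.
  rewrite (parE l1B l2B hl2B) (negbTE npar12).
  by move: nh; rewrite (parE l1B hl1B hl2B) par1 //; case: parallel.
have [C1 D1 O1] := parallel_stabilizer pl1 par1.
have [C2 D2 O2] := parallel_stabilizer pl2 par2.
have pos (l : line S) : l \in B ->
    #|[set x in A | inc x l]| = #|[set x in A | inc x l]|.-1.+1.
  by move=> lB; rewrite prednK // ltnW // points2.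
have E1 := pos l1 l1B; have E2 := pos l2 l2B.
set a := _.-1 in E1; set b := _.-1 in E2.
exists b, a; split; first exact: (sub_grid QS AB two_lines l1B l2B).
exists (line_stabilizer l2), (line_stabilizer l1).
rewrite !addn1 -E1 -E2 -C1 -C2; split; last by split; split.
split; try exact: line_stabilizer_sub.
apply/eqP; rewrite eqEsubset mul_subG ?line_stabilizer_sub // andbT.
apply/subsetP => h hH.
have hl2B := BH hH l2B.
have nhl : ~~ parallel l1 (h.2 l2).
  by rewrite parallelC (parE l2B hl2B l1B) par2 // parallelC (negbTE npar12).
(* The element [y] taking p to this point fixes [l1] and agrees with [h] on [l2], because parallel
   lines on a common point coincide. So [h * y^-1] fixes [l2], which factors [h]. *)
have [x [xA xl1 xhl2]] := meet l1B hl2B nhl.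
have [y yH Ey] := transH xA.
have yl2 : y.2 l2 = h.2 l2.
  apply: (parallel_eq (x := x)) => //; first by rewrite -Ey incH.
  by rewrite (parE l2B) ?BH // !par2.
apply/mulsgP; exists (h * y^-1)%g y; rewrite ?mulgKV // inE ?groupM ?groupV ?yH //.
  by rewrite lineM -yl2 lineK eqxx.
apply/eqP; apply: (parallel_eq (x := x)) => //; first by rewrite -Ey incH.
by rewrite parallelC par1.
Qed.

Section Swap.

Variable k : biperm S.
Hypotheses (kH : k \in H) (swap_k : ~~ parallel l1 (k.2 l1)).

Let exists_swap : exists g : biperm S, [/\ g \in H, inc (pt p g) l1 & g.2 l2 = l1].
Proof.
suff [g [gH gl1 npar]] : exists g : biperm S,
    [/\ g \in H, inc (pt p g) l1 & ~~ parallel l1 (g.2 l1)].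
  exists g; split=> //; have [E|//] := lines_at gH l1B gl1.
  by rewrite E parallelxx in npar.
have kl1B := BH kH l1B.
(* Both this point and its preimage under [k] are on [l1]. The elements [a] and [b] that take p to
   them satisfy a = bk, and [k] exchanges the two classes, so one of them does so too. *)
have [x [xA xl1 xkl1]] := meet l1B kl1B swap_k.
have [a aH Ea] := transH xA.
have [b bH Eb] : exists2 b, b \in H & pt p b = pt x k^-1%g by apply/transH/AH; rewrite ?groupV.
have Eab : a = (b * k)%g.
  by apply: (freeH (x := p)); rewrite ?groupM // ptM Eb ptKV.
have [pb|npb] := boolP (parallel l1 (b.2 l1)).
  exists a; rewrite Ea; split=> //.
  have := pb; rewrite -(parallelH _ _ kH) -lineM -Eab => pk.
  by move: pk; rewrite (parE l1B) ?BH // (negbTE swap_k); case: parallel.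
by exists b; rewrite Eb incHV.
Qed.

Let all_points l : l \in B -> #|[set x in A | inc x l]| = #|[set x in A | inc x l1]|.
Proof.
move=> lB; have [pl|npl] := boolP (parallel l1 l).
  by rewrite (card_disjoint_lines QS AB l1B lB pl).
rewrite -(card_line_image l1 kH); apply: (card_disjoint_lines QS AB) => //.
  exact: BH.
by rewrite (parE l1B) ?BH // (negbTE npl) (negbTE swap_k).
Qed.

(** For the bound by t, the two parallel classes are the sides of a complete bipartite configuration
    in the dual quadrangle, of order (t, s). *)
Let grid_size_le (s1 : nat) : 1 < t -> #|[set x in A | inc x l1]| = s1.+1 ->
  s1 <= minn s t.
Proof.
move=> t_gt1 cl1; rewrite leq_min; apply/andP; split.
  rewrite -ltnS -cl1 -(card_points l1); apply/subset_leq_card/subsetP => x.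
  by rewrite !inE => /andP [].
have parl (b : bool) : pairwise_noncollinear (S := dual S) [set m in B | parallel l1 m == b].
  move=> l m; rewrite !inE => /andP [lB /eqP pl] /andP [mB /eqP pm] nlm.
  have : parallel l m by rewrite (parE l1B lB mB) pl pm eqxx.
  by rewrite /parallel (negbTE nlm).
rewrite -ltnS; apply: (@complete_bipartite_le t s (dual S) (quadrangular_dual QS)
  card_lines card_points [set m in B | parallel l1 m == true]
  [set m in B | parallel l1 m == false]) => //.
- rewrite -cl1 -(all_points l2B) -(card_nparallel_sub QS AB two_lines l2B).
  congr #|pred_of_set _|; apply/setP => m; rewrite !inE.
  have [mB|//] := boolP (m \in B); rewrite (parE l1B l2B mB) (negbTE npar12).
  by case: parallel.
- rewrite -cl1 -(card_nparallel_sub QS AB two_lines l1B).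
  by congr #|pred_of_set _|; apply/setP => m; rewrite !inE eqbF_neg.
- rewrite -setI_eq0; apply/eqP/setP => m; rewrite !inE.
  by case: parallel; rewrite !(andbF, andbT).
- move=> l m; rewrite !inE => /andP [lB /eqP pl] /andP [mB /eqP pm].
  have [|x [xA xl xm]] := meet lB mB; first by rewrite (parE l1B) // pl pm.
  by apply/existsP; exists x; apply/andP.
Qed.

Lemma swapped_grid_case : 1 < t ->
  exists s1 : nat, thin_quadrangle_s1 s1 (substructure A B) /\ s1 <= minn s t /\
    exists (X1 : {group biperm S}) (g1 : biperm S),
      [/\ X1 \subset H, 2 * #|X1| = s1 + 1, g1 \in H
        & H = <<g1 |: X1>>%g :> {set biperm S}] /\
      exists l1 l2 : line S,
        [/\ l1 != l2,
            [set l in B | inc p l] = [set l1; l2],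
            [set g in H | inc (pt p g) l1] = X1 :|: (g1 *: X1)%g
          & [set g in H | inc (pt p g) l2] =
              (g1 *: X1 :* g1^-1)%g :|: (X1 :* g1^-1)%g].
Proof.
move=> t_gt1; have [g [gH pgl1 gl2]] := exists_swap.
have gVl1 : g^-1%g.2 l1 = l2 by rewrite -gl2 lineK.
set X := line_stabilizer l1.
have XE h : (h \in X) = (h \in H) && (h.2 l1 == l1) by rewrite inE.
(* Since products act from left to right and [g] takes [l2] to [l1], the four cosets of the
   statement are the sets of elements taking a given one of [l1], [l2] to a given one. *)
have gXE h : (h \in (g *: X)%g) = (h \in H) && (h.2 l2 == l1).
  by rewrite mem_lcoset XE groupMl ?groupV // lineM gVl1.
have inj_g (l m : line S) : (g.2 l == g.2 m) = (l == m) by rewrite (inj_eq perm_inj).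
have XgE h : (h \in (X :* g^-1)%g) = (h \in H) && (h.2 l1 == l2).
  by rewrite mem_rcoset invgK XE groupMr // lineM -{2}gl2 inj_g.
have gXgE h : (h \in (g *: X :* g^-1)%g) = (h \in H) && (h.2 l2 == l2).
  by rewrite mem_rcoset invgK gXE groupMr // lineM -gl2 inj_g.
have on_line m h : m \in B -> h \in H ->
    inc (pt p h) m = (h.2 l1 == m) || (h.2 l2 == m).
  move=> mB hH; apply/idP/orP => [phm|[] /eqP <-]; rewrite ?incH //.
  by have [->|->] := lines_at hH mB phm; rewrite eqxx; [left|right].
have D1 : [set h in H | inc (pt p h) l1] = X :|: (g *: X)%g.
  apply/setP => h; rewrite in_setU gXE XE inE.
  by have [hH|//] := boolP (h \in H); rewrite on_line.
have D2 : [set h in H | inc (pt p h) l2] = (g *: X :* g^-1)%g :|: (X :* g^-1)%g.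
  apply/setP => h; rewrite in_setU gXgE XgE inE.
  by have [hH|//] := boolP (h \in H); rewrite on_line // orbC.
have c1gt1 := points2 l1B.
pose s1 := #|[set x in A | inc x l1]|.-1.
have cs1 : #|[set x in A | inc x l1]| = s1.+1 by rewrite prednK // ltnW.
exists s1; split; last split; last first.
- exists X, g; split; last by exists l1, l2.
  have gX : g |: X \subset H by rewrite subUset sub1set gH line_stabilizer_sub.
  split=> //; first exact: line_stabilizer_sub.
    rewrite addn1 -cs1 -(card_points_subset (fun x => inc x l1)) D1 cardsU card_lcoset.
    rewrite (_ : _ :&: _ = set0) ?cards0 ?subn0 ?mul2n ?addnn //.
    apply/setP => h; rewrite in_setI gXE XE !inE.
    apply/negP => /andP [/andP [_ /eqP E1] /andP [_ /eqP E2]].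
    by case/eqP: nl12; apply: (@perm_inj _ h.2); rewrite E1 E2.
  apply/eqP; rewrite eqEsubset gen_subG gX andbT.
  pose J := <<g |: X>>%G.
  have gJ : g \in J by rewrite mem_gen // !inE eqxx.
  have XJ x : x \in X -> x \in J by move=> xX; rewrite mem_gen // in_setU xX orbT.
  have D1J h : h \in H -> inc (pt p h) l1 -> h \in J.
    move=> hH phl; have : h \in [set h in H | inc (pt p h) l1] by rewrite inE hH.
    rewrite D1 in_setU => /orP [/XJ //|]; rewrite mem_lcoset => /XJ.
    by rewrite groupMl // groupV.
  have D2J h : h \in H -> inc (pt p h) l2 -> h \in J.
    move=> hH phl; have : h \in [set h in H | inc (pt p h) l2] by rewrite inE hH.
    rewrite D2 in_setU !mem_rcoset !invgK mem_lcoset => /orP [] /XJ.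
      by rewrite groupMl ?groupV // groupMr.
    by rewrite groupMr.
  apply/subsetP => h hH; change (h \in J).
  (* The line [n] on the image of p under [h] meets [l1] in a point x. If [d] takes p to x, then [n]
     is the image of [l1] or [l2] under [d], so both [d] and [h * d^-1] take p onto [l1] or [l2] and
     are in [J]. *)
  have [n [nB phn npn]] : exists n, [/\ n \in B, inc (pt p h) n & ~~ parallel l1 n].
    have : ~~ parallel (h.2 l1) (h.2 l2) by rewrite parallelH.
    rewrite (parE l1B) ?BH //.
    have [p1|np1] := boolP (parallel l1 (h.2 l1)); last first.
      by exists (h.2 l1); rewrite BH ?incH.
    have [p2|np2] := boolP (parallel l1 (h.2 l2)) => // _.
    by exists (h.2 l2); rewrite BH ?incH.
  have [x [xA xl1 xn]] := meet l1B nB npn.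
  have [d dH Ed] := transH xA.
  rewrite -[h](mulgKV d) groupM //; last by apply: D1J; rewrite ?Ed.
  rewrite -Ed in xn; have [En|En] := lines_at dH nB xn.
    by apply: D1J; rewrite ?groupM ?groupV // ptM incHV // En.
  by apply: D2J; rewrite ?groupM ?groupV // ptM incHV // En.
- exact: grid_size_le.
split.
  apply: (sub_generalized_quadrangle QS AB pA) => //.
    by rewrite -ltnS -cs1.
  by move=> l lB; rewrite all_points.
by apply: (sub_grid QS AB two_lines l1B l2B) => //; rewrite all_points.
Qed.

End Swap.

End Grid.

(** * Two points on each line: dual grids *)

Section DualGrid.

Hypothesis points2 : forall l, l \in B -> #|[set x in A | inc x l]| = 2.
Variable t1 : nat.
Hypotheses (t1_gt1 : 1 < t1) (cLp : #|[set l in B | inc p l]| = t1.+1).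

Let par : rel (point S) := @parallel (dual S).

Let QD := quadrangular_dual QS.
Let DAB := closed_substructure_dual AB.

Let parE x y z : x \in A -> y \in A -> z \in A -> par y z = (par x y == par x z).
Proof. exact: (parallel_class_sub QD DAB points2). Qed.

Let parH h x y : h \in H -> par (pt x h) (pt y h) = par x y.
Proof.
move=> hH; rewrite /par /parallel (inj_eq perm_inj); congr (_ || ~~ _).
apply/existsP/existsP => /= -[l xyl]; last by exists (h.2 l); rewrite !incH.
by exists (h^-1%g.2 l); rewrite -(incH x _ hH) -(incH y _ hH) lineKV.
Qed.

Let card_lines_sub x : x \in A -> #|[set l in B | inc x l]| = t1.+1.
Proof. by move=> xA; rewrite card_lines_homogeneous. Qed.

Let exists_npar : exists2 q, q \in A & ~~ par p q.
Proof.
have /card_gt0P [l] : 0 < #|[set l in B | inc p l]| by rewrite cLp.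
rewrite inE => /andP [lB pl].
have [|q] := @exists_other _ [set x in A | inc x l] p; first by rewrite points2.
rewrite inE => /andP [qA ql] npq; exists q => //; apply: contraNN npq.
by move/(@parallel_eq (dual S) l p q pl ql) ->.
Qed.

(** The class of p consists of the points collinear with and distinct from a point q of the other
    class; there is one on each of the t1 + 1 lines of B on q. The other class is counted from p. *)
Let card_class (b : bool) : #|[set x in A | par p x == b]| = t1.+1.
Proof.
have [q qA npq] := exists_npar.
case: b.
  rewrite -(card_lines_sub qA) -(card_nparallel_sub QD DAB points2 qA).
  congr #|pred_of_set _|; apply/setP => x; rewrite !inE.
  have [xA|//] := boolP (x \in A); rewrite -/(par q x) (parE pA qA xA) (negbTE npq).
  by case: (par p x).
rewrite -(card_lines_sub pA) -(card_nparallel_sub QD DAB points2 pA).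
by congr #|pred_of_set _|; apply/setP => x; rewrite !inE eqbF_neg.
Qed.

Let noncollinear_class (b : bool) : pairwise_noncollinear [set x in A | par p x == b].
Proof.
move=> x y; rewrite !inE => /andP [xA /eqP px] /andP [yA /eqP py] nxy.
have : par x y by rewrite (parE pA) // px py eqxx.
by rewrite /par /parallel (negbTE nxy).
Qed.

Let class_group_set : group_set [set h in H | par p (pt p h)].
Proof.
apply/group_setP; split=> [|h k].
  by rewrite inE group1 [pt p _]perm1; apply: parallelxx.
rewrite !inE => /andP [hH ph] /andP [kH pk]; rewrite groupM //= ptM.
by move: ph; rewrite -(parH _ _ kH) (parE pA) ?AH // pk; case: (par p _).
Qed.

Let dual_grid_size_le : 1 < s -> t1 <= minn s t.
Proof.
move=> s_gt1; rewrite leq_min; apply/andP; split; last first.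
  rewrite -ltnS -cLp -(card_lines p); apply/subset_leq_card/subsetP => l.
  by rewrite !inE => /andP [].
rewrite -ltnS; apply: (complete_bipartite_le QS card_points card_lines s_gt1
  (card_class true) (card_class false)) => //.
  rewrite -setI_eq0; apply/eqP/setP => x; rewrite !inE.
  by case: (par p x); rewrite !(andbF, andbT).
move=> x y; rewrite !inE => /andP [xA /eqP px] /andP [yA /eqP py].
have : ~~ par x y by rewrite (parE pA) // px py.
by case/nparallelP=> _ [l xl yl]; apply/existsP; exists l; apply/andP.
Qed.

Lemma dual_grid_case : 1 < s ->
  exists t1 : nat, thin_quadrangle_1t t1 (substructure A B) /\ 2 <= t1 <= minn s t /\
    exists K : {group biperm S},
      [/\ K \subset H, #|H : K|%g = 2 & pairwise_noncollinear (points_of p K)].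
Proof.
move=> s_gt1; exists t1; split; last split; first 1 last.
- by rewrite t1_gt1 dual_grid_size_le.
- have KH : Group class_group_set \subset H by apply/subsetP => h; rewrite inE => /andP [].
  exists (Group class_group_set); split=> //.
    (* The subgroup corresponds to the class of p, which has half of the 2 (t1 + 1) points of A. *)
    rewrite -divgS // card_regular -(cardsID [set x in A | par p x == true]) /=.
    rewrite (card_points_subset (par p)).
    have EI : A :&: [set x in A | par p x == true] = [set x in A | par p x == true].
      by apply/setP => x; rewrite !inE; case: (x \in A).
    have ED : A :\: [set x in A | par p x == true] = [set x in A | par p x == false].
      by apply/setP => x; rewrite !inE; case: (x \in A) => //=; case: (par p x).
    have EK : [set x in A | par p x] = [set x in A | par p x == true].
      by apply/setP => x; rewrite !inE eqb_id.
    by rewrite EI ED EK !card_class addnn -muln2 mulKn.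
  move=> x y /imsetP [h + ->] /imsetP [k + ->]; rewrite !inE => /andP [hH ph] /andP [kH pk].
  by apply: (noncollinear_class (b := true)); rewrite inE AH ?ph ?pk.
split.
  apply: (sub_generalized_quadrangle QS AB pA) => //; exact: ltnW.
have [q qA npq] := exists_npar; apply: is_dual_grid_of_dual.
exact: (sub_grid QD DAB points2 pA qA npq cLp (card_lines_sub qA)).
Qed.

End DualGrid.

Lemma three_lines_case : 1 < s -> 2 < #|[set l in B | inc p l]| ->
  (forall l, l \in B -> 1 < #|[set x in A | inc x l]|) ->
  (exists t1 : nat, thin_quadrangle_1t t1 (substructure A B) /\ 2 <= t1 <= minn s t /\
    exists K : {group biperm S},
      [/\ K \subset H, #|H : K|%g = 2 & pairwise_noncollinear (points_of p K)]) \/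
  (exists s' t' : nat, generalized_quadrangle s' t' (substructure A B) /\ 2 <= minn s' t').
Proof.
move=> s_gt1 L3 points2.
have const := card_lines_const QS AB points2.
have {}const : {in B &, forall l m, #|[set x in A | inc x l]| = #|[set x in A | inc x m]|}.
  by apply: const => x xA; rewrite card_lines_homogeneous.
have [t1 cLp] : exists t1, #|[set l in B | inc p l]| = t1.+1.
  by exists #|[set l in B | inc p l]|.-1; rewrite prednK // ltnW // ltnW.
rewrite cLp in L3.
have /card_gt0P [l0] : 0 < #|[set l in B | inc p l]| by rewrite cLp.
rewrite inE => /andP [l0B _].
have [s' cl0] : exists s', #|[set x in A | inc x l0]| = s'.+1.
  by exists #|[set x in A | inc x l0]|.-1; rewrite prednK // ltnW // points2.
have cl l : l \in B -> #|[set x in A | inc x l]| = s'.+1.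
  by move=> lB; rewrite -cl0; apply: const.
have s'_gt0 : 0 < s' by rewrite -ltnS -cl0 points2.
have [s'1|s'_gt1] := leqP s' 1; [left | right].
  have points_eq2 l : l \in B -> #|[set x in A | inc x l]| = 2.
    by move=> lB; rewrite cl //; congr _.+1; apply/eqP; rewrite eqn_leq s'1.
  exact: (dual_grid_case points_eq2 L3 cLp s_gt1).
exists s', t1; split; last by rewrite leq_min s'_gt1.
apply: (sub_generalized_quadrangle QS AB pA) => // [|x xA]; first exact: ltnW.
by rewrite card_lines_homogeneous.
Qed.

End RegularSubstructure.

(** * The fixed substructure of a multiplier *)

Theorem theorem3p3 (S : incidence_structure) (s t : nat)
    (hs : 2 <= s) (ht : 2 <= t) (hS : generalized_quadrangle s t S)
    (G : {group biperm S}) (hG : G \subset automorphisms S)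
    (hreg : regular_on_points G) (p : point S)
    (theta : {perm biperm S}) (htheta : theta \in Aut G)
    (phi : biperm S) (hphi : induces G p theta phi) :
  let H : {set biperm S} := fixed_subgroup G theta in
  let P0 := fixed_points phi in
  let L0 := fixed_lines phi in
  let Sth := fixed_substructure phi in
  H = 1%g \/
  (1 < #|H| /\
   (* (a) *)
   ((partial_ovoid P0 L0 /\ #|H| <= 1 + s * t) \/
   (* (b) *)
    (on_common_line (points_of p H) /\ #|H| %| 1 + s) \/
   (* (c) *)
    (exists s1 s2 : nat, is_grid s1 s2 Sth /\
       exists Y1 Y2 : {group biperm S},
         [/\ Y1 \subset H, Y2 \subset H & H = (Y1 * Y2)%g] /\
         [/\ #|Y1| = s1 + 1, s1 + 1 %| s + 1 & on_common_line (points_of p Y1)] /\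
         [/\ #|Y2| = s2 + 1, s2 + 1 %| s + 1 & on_common_line (points_of p Y2)]) \/
   (* (c') *)
    (exists s1 : nat, thin_quadrangle_s1 s1 Sth /\ s1 <= minn s t /\
       exists (X1 : {group biperm S}) (g1 : biperm S),
         [/\ X1 \subset H, 2 * #|X1| = s1 + 1, g1 \in H & H = <<g1 |: X1>>%g] /\
         exists l1 l2 : line S,
           [/\ l1 != l2,
               [set l in L0 | inc p l] = [set l1; l2],
               [set g in H | inc (pt p g) l1] = X1 :|: (g1 *: X1)%g
             & [set g in H | inc (pt p g) l2] =
                 (g1 *: X1 :* g1^-1)%g :|: (X1 :* g1^-1)%g]) \/
   (* (d) *)
    (exists t1 : nat, thin_quadrangle_1t t1 Sth /\ 2 <= t1 <= minn s t /\
       exists K : {group biperm S},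
         [/\ K \subset H, #|H : K|%g = 2 & pairwise_noncollinear (points_of p K)]) \/
   (* (e) *)
    (exists s' t' : nat, generalized_quadrangle s' t' Sth /\ 2 <= minn s' t'))).

Proof.
move=> H P0 L0 Sth.
have QS := gq_quadrangular hS; have [lin tri pr] := QS.
have [_ _ card_points card_lines] := hS.
case: hphi => autphi phiE.
have autE (f : biperm S) x l : f \in automorphisms S -> inc (pt x f) (f.2 l) = inc x l.
  by rewrite inE => /forallP /(_ x) /forallP /(_ l) /eqP.
have reach x : exists2 g, g \in G & pt p g = x.
  by have [g [[gG gx] _]] := hreg p x; exists g.
have freeG x : {in G &, injective (fun g => pt x g)}.
  move=> g h gG hG' E; have [k [_ kU]] := hreg x (pt x g).
  by rewrite -(kU g) // -(kU h).
have thetaM (g h : biperm S) : g \in G -> h \in G -> theta (g * h)%g = (theta g * theta h)%g.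
  by move: htheta g h; rewrite inE => /andP [_ /morphicP].
have thetaG g : g \in G -> theta g \in G.
  exact: Aut_closed.
have theta1 : theta 1%g = 1%g.
  by apply: (mulgI (theta 1%g)); rewrite -thetaM ?mulg1.
have gH : group_set H.
  apply/group_setP; split=> [|h k]; first by rewrite inE group1 theta1 eqxx.
  rewrite !inE => /andP [hG' /eqP hh] /andP [kG /eqP kk].
  by rewrite groupM // thetaM // hh kk eqxx.
pose HG := Group gH.
have HGsub : HG \subset G by apply/subsetP => h; rewrite inE => /andP [].
(* Writing x as the image of p under g, this is theta(gh) = theta(g) h, as [theta] fixes [h]. *)
have phi_pt h x : h \in H -> pt (pt x h) phi = pt (pt x phi) h.
  rewrite inE => /andP [hG' /eqP hh]; have [g gG' <-] := reach x.
  by rewrite -(ptM p g h) phiE ?groupM // thetaM // hh ptM phiE.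
have P0E x : (x \in P0) = (pt x phi == x) by rewrite inE.
have L0E l : (l \in L0) = (phi.2 l == l) by rewrite inE.
have pP0 : p \in P0.
  have p1 : pt p 1%g = p := perm1 p.
  by rewrite P0E -{1}p1 phiE // theta1 p1.
have autH : HG \subset automorphisms S := subset_trans HGsub hG.
have inH h x l : h \in H -> inc (pt x h) (h.2 l) = inc x l.
  by move=> hH; apply/autE/(subsetP autH).
have freeH x : {in HG &, injective (fun h => pt x h)}.
  by move=> h k hH kH; apply: freeG; apply: (subsetP HGsub).
(* Commutation on points passes to lines because two points of a line determine it. *)
have phi_line (h : biperm S) l : h \in H -> h.2 (phi.2 l) = phi.2 (h.2 l).
  move=> hH; have /card_gt1P [x [y []]] : 1 < #|[set x : point S | inc x l]|.
    by rewrite card_points ltnS ltnW.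
  rewrite !inE => xl yl nxy.
  apply: (lin (pt (pt x phi) h) (pt (pt y phi) h)).
  - by rewrite inH // autE.
  - by rewrite inH // autE.
  - by rewrite -phi_pt // autE // inH.
  - by rewrite -phi_pt // autE // inH.
  - by rewrite !(inj_eq perm_inj).
have closed : closed_substructure P0 L0.
  split=> [x y l|l m x|x l].
  - rewrite !P0E L0E => /eqP xphi /eqP yphi nxy xl yl; apply/eqP.
    have xl' : inc x (phi.2 l) by rewrite -xphi autE.
    have yl' : inc y (phi.2 l) by rewrite -yphi autE.
    exact: (lin _ _ _ _ xl' yl').
  - rewrite !L0E P0E => /eqP lphi /eqP mphi nlm xl xm.
    apply: contraNT nlm => nx; apply/eqP.
    have xl' : inc (pt x phi) l by rewrite -lphi autE.
    have xm' : inc (pt x phi) m by rewrite -mphi autE.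
    exact: (lin _ _ _ _ xl' xl xm' xm).
  - rewrite P0E L0E => /eqP xphi /eqP lphi nxl.
    have [y [m [xm ym yl]]] := pr _ _ nxl.
    have xm' : inc x (phi.2 m) by rewrite -xphi autE.
    have ym' : inc (pt y phi) (phi.2 m) by rewrite autE.
    have yl' : inc (pt y phi) l by rewrite -lphi autE.
    have yphi : pt y phi = y.
      (* If the projection y of x moved, then x, y and its image would form a triangle with an edge
         on l, putting x on l. *)
      apply/eqP/negPn/negP => ny; case/negP: nxl.
      exact: (tri _ _ _ _ _ _ yl' yl ny ym xm xm' ym').
    have nxy : x != y by apply: contraNneq nxl => ->.
    exists y, m; rewrite P0E L0E yphi; split=> //; apply/eqP.
    by rewrite yphi in ym'; apply: (lin x y).
have HP0 h x : h \in HG -> x \in P0 -> pt x h \in P0.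
  by move=> hH; rewrite !P0E phi_pt // => /eqP ->.
have HL0 (h : biperm S) l : h \in HG -> l \in L0 -> h.2 l \in L0.
  by move=> hH; rewrite !L0E -phi_line // => /eqP ->.
(* A fixed point is the image of p under some g, and also under theta(g); by regularity theta(g) =
   g. *)
have transH x : x \in P0 -> exists2 h, h \in HG & pt p h = x.
  have [g gG <-] := reach x; rewrite P0E phiE // => /eqP E.
  by exists g; rewrite // inE gG; apply/eqP/(freeG p); rewrite ?thetaG.
have [H1|H_gt1] := leqP #|H| 1; first by left; apply: (card_le1_trivg (G := HG)).
right; split=> //.
have points_H : points_of p H = P0 := points_of_regular HP0 pP0 transH.
have caseb : on_common_line P0 -> #|H| %| 1 + s :=
  common_line_case QS card_points autH freeH HP0 pP0 transH H_gt1.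
have [/eqP|L_gt0] := posnP #|[set l in L0 | inc p l]|.
  rewrite cards_eq0 => /eqP L0p; left.
  have ovoid := noncollinear_case closed autH HL0 pP0 transH L0p.
  split=> //; rewrite (card_regular freeH HP0 pP0 transH).
  exact: (card_partial_ovoid_le QS card_points card_lines (proj2 ovoid)).
right; have [L_le1|L_gt1] := leqP #|[set l in L0 | inc p l]| 1.
  left; rewrite points_H; suff line : on_common_line P0 by split=> //; apply: caseb.
  apply: (one_line_case closed autH HL0 transH).
  by apply/eqP; rewrite eqn_leq L_le1.
have [line|points2] := two_points_case QS closed autH freeH HP0 HL0 pP0 transH H_gt1 L_gt1.
  by left; rewrite points_H; split=> //; apply: caseb.
right; have [L_le2|L_gt2] := leqP #|[set l in L0 | inc p l]| 2; last first.
  right; right.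
  exact: (three_lines_case QS card_points card_lines closed autH freeH HP0 HL0 pP0 transH).
have /cards2P [l1 [l2 [nl12 lines_p]]] : #|[set l in L0 | inc p l]| == 2.
  by rewrite eqn_leq L_le2.
have [/forallP par|/forallPn [k]] :=
  boolP [forall h : biperm S, (h \in H) ==> parallel l1 (h.2 l1)].
  left.
  apply: (parallel_grid_case QS card_points closed autH freeH HP0 HL0 pP0 transH
    nl12 lines_p points2).
  by move=> h hH; apply: (implyP (par h)).
rewrite negb_imply => /andP [kH swap_k]; right; left.
exact: (swapped_grid_case QS card_points card_lines closed autH freeH HP0 HL0 pP0 transH
  nl12 lines_p points2 kH swap_k).
Qed.
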